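(* Let $n\in\mathbb{N}$, let $0=\alpha_0<\alpha_1<\dots<\alpha_n$ be real numbers, and let $b>0$. Set $\mathcal{F}=\{x^{\alpha_i}\}_{i=0}^n$ and let $L:\operatorname{lin}\mathcal{F}\to\mathbb{R}$ be a linear functional. Then the following are equivalent: (i) $L$ is a truncated $[0,b]$-moment functional. (ii) $L(p)\ge 0$ holds for all polynomials $p$ of the following forms and all points with $0<x_1<\dots<x_m<b$: if $n=2m$, both $$p(x)=\det\begin{pmatrix} 1&x^{\alpha_1}&x^{\alpha_2}&\dots&x^{\alpha_{2m-1}}&x^{\alpha_{2m}}\\ x&(x_1&x_1)&\dots&(x_m&x_m)\end{pmatrix}$$ and $$p(x)=\det\begin{pmatrix} x^{\alpha_1}&x^{\alpha_2}&x^{\alpha_3}&\dots&x^{\alpha_{2m-2}}&x^{\alpha_{2m-1}}&x^{\alpha_{2m}}\\ x&(x_1&x_1)&\dots&(x_{m-1}&x_{m-1})&b\end{pmatrix};$$ if $n=2m+1$, both $$p(x)=\det\begin{pmatrix} x^{\alpha_1}&x^{\alpha_2}&x^{\alpha_3}&\dots&x^{\alpha_{2m}}&x^{\alpha_{2m+1}}\\ x&(x_1&x_1)&\dots&(x_m&x_m)\end{pmatrix}$$ and $$p(x)=\det\begin{pmatrix} 1&x^{\alpha_1}&x^{\alpha_2}&\dots&x^{\alpha_{2m-1}}&x^{\alpha_{2m}}&x^{\alpha_{2m+1}}\\ x&(x_1&x_1)&\dots&(x_m&x_m)&b\end{pmatrix}.$$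
   Context: $\operatorname{lin}\mathcal{F}$ is the real vector space of finite linear combinations of the functions in $\mathcal{F}$; $x^0=1$ is the constant function, and $0^\alpha=0$ for $\alpha>0$. $L$ is a truncated $[0,b]$-moment functional if there is a (positive) measure $\mu$ on $[0,b]$ with $L(f)=\int_0^b f\,d\mu$ for all $f\in\operatorname{lin}\mathcal{F}$. Matrix notation: for functions $g_0,\dots,g_k$ and points $z_0,\dots,z_k$, $\begin{pmatrix} g_0&\dots&g_k\\ z_0&\dots&z_k\end{pmatrix}$ denotes the $(k+1)\times(k+1)$ matrix whose row belonging to the point $z_j$ is $(g_0(z_j),\dots,g_k(z_j))$. A bracketed pair $(z\ \ z)$ in the bottom line stands for two consecutive rows: $(g_0(z),\dots,g_k(z))$ followed by the row of derivatives $(g_0'(z),\dots,g_k'(z))$. In the top line $x^{\alpha_i}$ denotes the function $t\mapsto t^{\alpha_i}$; the bottom-line entry $x$ is the variable of $p$. *)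

(* Defs.v *)
From mathcomp Require Import all_boot all_order all_algebra.
From mathcomp Require Import all_classical all_reals all_analysis.
Import Order.TTheory GRing.Theory Num.Theory.
Import numFieldNormedType.Exports.

Set Implicit Arguments.
Unset Strict Implicit.
Unset Printing Implicit Defensive.

Local Open Scope classical_set_scope.
Local Open Scope ring_scope.

(* [powR] satisfies 0 `^ 0 = 1 and 0 `^ a = 0 for a != 0.  Its values at
   negative t are irrelevant below: two real linear combinations of such
   powers that agree on some [0, b] with b > 0 are equal. *)
Definition powers {R : realType} (k : nat) (a : 'I_k -> R) : 'I_k -> R -> R :=
  fun i t => t `^ a i.

Definition lin {R : realType} (k : nat) (F : 'I_k -> R -> R) : set (R -> R) :=
  [set f | exists c : 'I_k -> R, f = (fun t => \sum_(i < k) c i * F i t)].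

(* A linear functional on V is represented by a function on all of R -> R
   whose values outside V are unconstrained. *)
Definition linear_functional_on {R : realType} (V : set (R -> R))
    (L : (R -> R) -> R) : Prop :=
  forall (a : R) (f g : R -> R), V f -> V g ->
    L (fun t => a * f t + g t) = a * L f + L g.

(* mu is a Borel measure on R of which only the restriction to K is used;
   integrability makes the integral a genuine real number. *)
Definition truncated_moment_functional {R : realType} (K : set R)
    (V : set (R -> R)) (L : (R -> R) -> R) : Prop :=
  exists mu : {measure set (measurableTypeR R) -> \bar R},
    forall f : R -> R, V f ->
      mu.-integrable K (EFin \o f) /\
      (L f)%:E = (\int[mu]_(x in K) (f x)%:E)%E.

(* Entries of the bottom line: [Single z] is a plain point z and
   [Double z] is a bracketed pair (z z). *)
Variant node (R : Type) : Type := Single of R | Double of R.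

(* The matrix row of a node for g_0, ..., g_k is (r g_0, ..., r g_k), with one
   evaluation r for a plain point and two for a bracketed pair. *)
Definition node_rows {R : realType} (p : node R) : seq ((R -> R) -> R) :=
  match p with
  | Single z => [:: fun g : R -> R => g z]
  | Double z => [:: fun g : R -> R => g z; fun g : R -> R => derive1 g z]
  end.

(* Meaningful when the nodes account for exactly k rows. *)
Definition node_mx {R : realType} (k : nat) (g : 'I_k -> R -> R)
    (s : seq (node R)) : 'M[R]_k :=
  \matrix_(i < k, j < k)
    nth (fun=> 0) (flatten [seq node_rows p | p <- s]) i (g j).

(* Main.v *)
Require Import Defs.
From mathcomp Require Import all_boot all_order all_algebra.
From mathcomp Require Import all_classical all_reals all_analysis.
From mathcomp Require Import perm measurable_realfun ring lra.
Import Order.TTheory GRing.Theory Num.Theory.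
Import numFieldNormedType.Exports.

(** The determinants of the statement are, as functions of the point in their
    first row, generalized polynomials (finite combinations of the powers
    t^alpha_i) that vanish at the remaining nodes, to second order at the
    bracketed ones.  Everything rests on one fact about these: a nonzero
    combination of k powers has at most k - 1 positive zeros, where a zero may
    count twice ([gpoly_zeros], an induction with Rolle's theorem).

    From the zero count, the determinant with increasing positive nodes is
    positive ([row_det_gt0]).  Moving the first row to its place among the
    others then shows that the node polynomial has at t the sign
    (-1)^(number of rows at nodes below t) ([node_poly_sign]).  For the four
    families of the statement that number is even on [0, b], so the polynomials
    are nonnegative there and every moment functional is nonnegative on them.

    Conversely, let g be positive on [0, b].  Among the p with 0 <= p <= g on
    [0, b] take one that maximises p(b + 1).  The graph of p must touch 0 and g
    alternately at n + 1 points ([snake]): otherwise at most n points separate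
    the contacts with 0, to which b + 1 is added, from the contacts with g
    ([alternation_or_separation]); a node polynomial that changes sign exactly
    at these points is then a direction in which p can still be increased.
    Hence both p and g - p are nonnegative with as many zeros as the zero count
    allows.  The count forces the first of these zeros to be 0 and the last to
    be b, and a polynomial with so many zeros is determined up to a factor, so
    p and g - p are nonnegative multiples of polynomials of the statement
    ([multiple_of_node_poly]) and L(g) >= 0 ([Lam_ge0]).

    It remains to represent a functional that is nonnegative on nonnegative
    polynomials.  The point of the cone generated by the curve
    t |-> (t^alpha_i)_i, for t in [0, b], that is closest to the vector of
    moments of L defines a nonnegative polynomial on which L would be negative
    if the two points differed ([conic_hull]); so the moments are those of a
    finite sum of point masses. *)

Set Implicit Arguments.
Unset Strict Implicit.
Unset Printing Implicit Defensive.

Local Open Scope classical_set_scope.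
Local Open Scope ring_scope.

(** * Zeros of generalized polynomials *)

Definition increasing_exp (R : realType) k (a : 'I_k -> R) :=
  forall i j : 'I_k, (i < j)%N -> a i < a j.

Definition gpoly (R : realType) k (a c : 'I_k -> R) (t : R) : R :=
  \sum_(i < k) c i * t `^ a i.

Definition pt (R : Type) (p : node R) : R :=
  match p with Single z => z | Double z => z end.

Definition rows (R : realType) (ns : seq (node R)) : seq ((R -> R) -> R) :=
  flatten [seq node_rows p | p <- ns].

Definition nth_row (R : realType) (rs : seq ((R -> R) -> R)) i : (R -> R) -> R :=
  nth (fun=> 0 : R) rs i.

(** Every evaluation attached to the nodes kills [f]; beyond the last row,
    [nth_row] is the zero functional, so that all [i] can be allowed. *)
Definition vanishes (R : realType) (f : R -> R) (ns : seq (node R)) :=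
  forall i, nth_row (rows ns) i f = 0.

Section Zeros.
Variable R : realType.
Implicit Types (ns : seq (node R)) (t z : R).

Lemma is_derive_gpoly k (a c : 'I_k -> R) z : 0 < z ->
  is_derive z 1 (gpoly a c) (gpoly (fun i => a i - 1) (fun i => c i * a i) z).
Proof.
move=> z0.
have -> : gpoly a c = \sum_(i < k) (c i *: (fun t => t `^ a i)).
  by apply/funext => t; rewrite fct_sumE.
apply: is_derive_eq.
  apply: is_derive_sum => i; apply: is_deriveZ; exact: is_derive1_powR.
by apply: eq_bigr => i _; rewrite -mulrA.
Qed.

Lemma derive1_gpoly k (a c : 'I_k -> R) z : 0 < z ->
  derive1 (gpoly a c) z = gpoly (fun i => a i - 1) (fun i => c i * a i) z.
Proof.
move=> z0; rewrite derive1E.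
by have ? := is_derive_gpoly a c z0; rewrite derive_val.
Qed.

Lemma gpolyM k (a c : 'I_k -> R) (e z : R) : 0 < z ->
  gpoly (fun i => a i + e) c z = z `^ e * gpoly a c z.
Proof.
move=> z0; rewrite /gpoly big_distrr; apply: eq_bigr => i _ /=.
by rewrite powRD ?(gt_eqF z0) ?implybT// [in RHS]mulrCA [z `^ e * _]mulrC.
Qed.

Lemma rows_gpoly k (a c : 'I_k -> R) ns i : path <%R 0 (map (@pt R) ns) ->
  nth_row (rows ns) i (gpoly a c) =
  \sum_(j < k) c j * nth_row (rows ns) i (powers a j).
Proof.
move=> /(order_path_min lt_trans).
elim: ns i => [|p ns IH] i /=.
  by move=> _; rewrite /nth_row nth_nil big1// => j _; rewrite mulr0.
case/andP; case: p => [z|z] z0 ns0; rewrite /rows /=.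
  by case: i => [//|i]; exact: IH.
case: i => [//|[|i]] /=; last exact: IH.
rewrite derive1_gpoly//; apply: eq_bigr => j _.
rewrite -mulrA derive1E; congr (_ * _).
by have ? := is_derive1_powR (a j) z0; rewrite derive_val.
Qed.

Lemma nth_rows0 p ns (f : R -> R) : nth_row (rows (p :: ns)) 0 f = f (pt p).
Proof. by case: p. Qed.

Lemma nth_rows_behead p ns i :
  nth_row (rows (p :: ns)) (size (node_rows p) + i) = nth_row (rows ns) i.
Proof. by case: p. Qed.

(** Rolle's theorem supplies a zero of the derivative strictly between two
    consecutive nodes, and each double node is itself one. *)
Lemma rolle_nodes (f : R -> R) p ns :
  (forall t, 0 < t -> derivable f t 1) -> path <%R 0 (map (@pt R) (p :: ns)) ->
  vanishes f (p :: ns) ->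
  exists zs, [/\ size zs = (size (rows (p :: ns))).-1, sorted <%R zs,
                 all (>= pt p) zs & forall z, z \in zs -> derive1 f z = 0].
Proof.
move=> df; elim: ns p => [|q ns IH] p /= pos van.
  case: p pos van => [z|z] pos van.
    by exists [::].
  exists [:: z]; split => //=; first by rewrite lexx.
  by move=> ?; rewrite inE => /eqP ->; exact: (van 1%N).
have [p0 [pq qns]] : 0 < pt p /\ pt p < pt q /\ path <%R (pt q) (map (@pt R) ns).
  by case/and3P: pos.
have q0 := lt_trans p0 pq.
have [zs [szs sozs allzs zzs]] : exists zs, [/\ size zs = (size (rows (q :: ns))).-1,
    sorted <%R zs, all (>= pt q) zs & forall z, z \in zs -> derive1 f z = 0].
  apply: IH; first by rewrite /= q0.
  by move=> i; rewrite -(nth_rows_behead p).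
have fp : f (pt p) = 0 by rewrite -(nth_rows0 p (q :: ns)).
have fq : f (pt q) = 0.
  by rewrite -(nth_rows0 q ns) -(nth_rows_behead p).
have [w wpq dw] : exists2 w, w \in `]pt p, pt q[%R & is_derive w 1 f 0.
  apply: Rolle => //.
  - by move=> x; rewrite in_itv /= => /andP[px _]; apply: df; exact: lt_trans px.
  - apply: derivable_within_continuous => x; rewrite in_itv /= => /andP[px _].
    by apply: df; exact: lt_le_trans px.
  - by rewrite fp fq.
move: wpq; rewrite in_itv /= => /andP[pw wq].
have sw : sorted <%R (w :: zs).
  rewrite /= (path_sortedE lt_trans) sozs andbT.
  by apply: sub_all allzs => x /=; exact: lt_le_trans.
have aw : all (> pt p) (w :: zs).
  by rewrite /= pw; apply: sub_all allzs => x /=; exact/lt_le_trans.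
have zw z : z \in w :: zs -> derive1 f z = 0.
  by rewrite inE => /orP[/eqP->|/zzs//]; rewrite derive1E derive_val.
have szrow : (0 < size (rows (q :: ns)))%N by case: (q).
case: p {pos pq IH} p0 fp pw aw van => z p0 fp pw aw van.
- exists (w :: zs); split => //.
  + by rewrite /= szs prednK.
  + by apply: sub_all aw => x /=; exact: ltW.
- exists (z :: w :: zs); split => //.
  + by rewrite /= szs prednK.
  + move: sw; rewrite /= => ->; by rewrite pw.
  + by rewrite /= lexx; apply: sub_all aw => x /=; exact: ltW.
  + by move=> x; rewrite inE => /orP[/eqP ->|/zw//]; exact: (van 1%N).
Qed.

Lemma vanishes_Singles (zs : seq R) (f : R -> R) :
  (forall z, z \in zs -> f z = 0) -> vanishes f [seq Single z | z <- zs].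
Proof.
move=> zzs i; elim: zs i zzs => [|z zs IH] [|i] zzs //=; first exact/zzs/mem_head.
by apply: IH => y yzs; apply: zzs; rewrite inE yzs orbT.
Qed.

Lemma nth_row_Single (zs : seq R) (f : R -> R) i : (i < size zs)%N ->
  nth_row (rows [seq Single z | z <- zs]) i f = f (nth 0 zs i).
Proof. by elim: zs i => [|z zs IH] [|i] //= ?; exact: IH. Qed.

Lemma size_rows_Single (zs : seq R) : size (rows [seq Single z | z <- zs]) = size zs.
Proof. by elim: zs => //= z zs IH; rewrite /rows /= -/(rows _) IH. Qed.

Lemma pt_Single (zs : seq R) : map (@pt R) [seq Single z | z <- zs] = zs.
Proof. by rewrite -map_comp map_id. Qed.

(** Descartes' bound on the number of positive zeros.  Dividing by the lowest
    power turns its term into a constant, which differentiation removes, and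
    by Rolle's theorem this costs only one zero.  All the zeros obtained for
    the derivative are plain points, so no higher multiplicities appear. *)
Lemma gpoly_zeros k (a c : 'I_k -> R) ns : increasing_exp a ->
  path <%R 0 (map (@pt R) ns) -> size (rows ns) = k ->
  vanishes (gpoly a c) ns -> forall i, c i = 0.
Proof.
elim: k a c ns => [|k IH] a c ns ai pos sz van; first by case.
case: ns pos sz van => [//|p ns] pos sz van.
pose F := gpoly (fun i => a i + - a ord0) c.
have dF t : 0 < t -> derive1 F t = gpoly (fun j => a (lift ord0 j) - a ord0 - 1)
    (fun j => c (lift ord0 j) * (a (lift ord0 j) - a ord0)) t.
  move=> t0; rewrite /F derive1_gpoly// /gpoly big_ord_recl subrr mulr0 mul0r add0r.
  by [].
have vanF : vanishes F (p :: ns).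
  move=> i.
  have pos' := order_path_min lt_trans pos.
  elim: (p :: ns) i pos' van => [|q l IHl] i /=; first by rewrite /nth_row nth_nil.
  case/andP; case: q => z z0 l0 van.
    case: i => [|i] /=.
      by rewrite /F gpolyM//; move: (van 0%N) => /= ->; rewrite mulr0.
    by apply: IHl => // j; exact: (van j.+1).
  case: i => [|[|i]] /=.
  - by rewrite /F gpolyM//; move: (van 0%N) => /= ->; rewrite mulr0.
  - have := van 0%N; have := van 1%N; rewrite /= derive1_gpoly// => v1 v0.
    rewrite derive1_gpoly//.
    transitivity (z `^ (- a ord0) * gpoly (fun i => a i - 1) (fun i => c i * a i) z
       - a ord0 * (z `^ (- a ord0 - 1) * gpoly a c z)); last first.
      by rewrite v0 v1 !mulr0 subr0.
    rewrite -!gpolyM// /gpoly [in X in _ - X]big_distrr -sumrB; apply: eq_bigr => j _ /=.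
    rewrite (_ : a j - 1 + - a ord0 = a j - a ord0 - 1); last by ring.
    rewrite (_ : a j + (- a ord0 - 1) = a j - a ord0 - 1); last by ring.
    by ring.
  - by apply: IHl => // j; exact: (van j.+2).
have dfF t : 0 < t -> derivable F t 1.
  by move=> t0; have ? := is_derive_gpoly (fun i => a i + - a ord0) c t0; exact: ex_derive.
have [zs [szs sozs allzs zzs]] := rolle_nodes dfF pos vanF.
have p0 : 0 < pt p by case/andP: pos.
have zs0 : all (> 0) zs by apply: sub_all allzs => x /=; exact: lt_le_trans.
have cl j : c (lift ord0 j) = 0.
  have lt0j : a ord0 < a (lift ord0 j) by apply: ai.
  suff /eqP : c (lift ord0 j) * (a (lift ord0 j) - a ord0) = 0.
    by rewrite mulf_eq0 subr_eq0 [X in _ || X]gt_eqF// orbF => /eqP.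
  apply: (IH (fun j => a (lift ord0 j) - a ord0 - 1)
    (fun j => c (lift ord0 j) * (a (lift ord0 j) - a ord0)) [seq Single z | z <- zs]).
  - by move=> i i' ii'; rewrite ltrD2r ltrD2r ai.
  - by rewrite pt_Single path_sortedE ?zs0//; exact: lt_trans.
  - by rewrite size_rows_Single szs sz.
  - apply: vanishes_Singles => z zzs'.
    by rewrite -dF ?zzs//; move/allP: zs0 => /(_ _ zzs').
have c0 : c ord0 = 0.
  have gp : gpoly a c (pt p) = 0.
    by rewrite -(nth_rows0 p ns).
  move: gp; rewrite /gpoly big_ord_recl big1 ?addr0; last first.
    by move=> j _; rewrite cl mul0r.
  by move/eqP; rewrite mulf_eq0 [X in _ || X]gt_eqF ?orbF ?powR_gt0// => /eqP.
by move=> i; case: (unliftP ord0 i) => [j ->|->].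
Qed.

End Zeros.

(** * Positivity of the node determinants *)

(** The matrices of the statement for arbitrary lists of functionals, which
    allows rows to be moved, replaced and duplicated. *)
Definition row_mx_of (R : realType) k (g : 'I_k -> R -> R)
    (rs : seq ((R -> R) -> R)) : 'M[R]_k :=
  \matrix_(i < k, j < k) nth_row rs i (g j).

Definition row_det (R : realType) k (g : 'I_k -> R -> R) rs : R :=
  \det (row_mx_of g rs).

Section RowDeterminants.
Variables (R : realType) (k : nat) (g : 'I_k -> R -> R).
Implicit Types (rs : seq ((R -> R) -> R)).

Lemma row_det_expand rs1 rs2 (i0 : 'I_k) : size rs1 = i0 -> forall r,
  row_det g (rs1 ++ r :: rs2) =
  \sum_(j < k) r (g j) * cofactor (row_mx_of g (rs1 ++ (fun=> 0 : R) :: rs2)) i0 j.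
Proof.
move=> sz r; rewrite /row_det (expand_det_row _ i0); apply: eq_bigr => j _.
rewrite mxE /nth_row nth_cat sz ltnn subnn /=; congr (_ * _).
rewrite /cofactor; congr (_ * \det _); apply/matrixP => x y; rewrite !mxE.
rewrite /nth_row !nth_cat sz; case: ltnP => // le_x.
have := neq_lift i0 x; rewrite -val_eqE /= eq_sym => ne_x.
have : (0 < lift i0 x - i0)%N by rewrite subn_gt0 ltn_neqAle eq_sym ne_x.
by move: le_x; rewrite /=; case: (_ - _)%N.
Qed.

Lemma row_det_swap rs1 r r' rs2 : ((size rs1).+1 < k)%N ->
  row_det g (rs1 ++ r :: r' :: rs2) = - row_det g (rs1 ++ r' :: r :: rs2).
Proof.
move=> sz; have sz' := ltnW sz.
pose i := Ordinal sz'; pose i' := Ordinal sz.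
(* Exchanging two rows is multiplication by a transposition matrix. *)
have -> : row_det g (rs1 ++ r :: r' :: rs2) =
    \det (xrow i i' (row_mx_of g (rs1 ++ r' :: r :: rs2))).
  congr (\det _); apply/matrixP => x y; rewrite !mxE /nth_row !nth_cat.
  have [->|xi] := eqVneq x i.
    by rewrite tpermL /= ltnn subnn ltnNge leqnSn /= subSn// subnn.
  have [->|xi'] := eqVneq x i'.
    by rewrite tpermR /= ltnn subnn ltnNge leqnSn /= subSn// subnn.
  rewrite tpermD 1?eq_sym//; case: ltnP => // le_x.
  have : (1 < x - size rs1)%N.
    rewrite ltn_subRL addn1 ltn_neqAle eq_sym (_ : (x : nat) != _)//=.
    by rewrite ltn_neqAle le_x eq_sym andbT.
  by case: (_ - _)%N => [|[|]].
rewrite xrowE det_mulmx det_perm odd_tperm.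
by rewrite -val_eqE /= neq_ltn ltnSn /= expr1 mulN1r.
Qed.

(** Moving one row down past the rows [rs1] takes [size rs1] transpositions. *)
Lemma row_det_insert rs0 r rs1 rs2 : (size rs0 + size rs1 < k)%N ->
  row_det g (rs0 ++ r :: rs1 ++ rs2) =
  (-1) ^+ size rs1 * row_det g (rs0 ++ rs1 ++ r :: rs2).
Proof.
elim: rs1 rs0 => [|r1 rs1 IH] rs0 sz; first by rewrite mul1r.
rewrite /= row_det_swap; last first.
  by apply: leq_ltn_trans sz; rewrite /= addnS ltnS leq_addr.
rewrite -cat_rcons IH; last by rewrite size_rcons addSn -addnS.
by rewrite cat_rcons exprS mulN1r mulNr.
Qed.

Lemma row_det_dup r rs1 rs2 : ((size rs1).+1 < k)%N ->
  row_det g (r :: rs1 ++ r :: rs2) = 0.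
Proof.
move=> sz; rewrite (@row_det_insert [::])/=; last exact: ltnW.
set d := row_det _ _; have : d = - d by rewrite {1}/d row_det_swap.
by move/eqP; rewrite -subr_eq0 opprK -mulr2n mulrn_eq0 /= => /eqP ->; rewrite mulr0.
Qed.

End RowDeterminants.

Section PositiveDeterminants.
Variable R : realType.
Implicit Types (ns : seq (node R)) (t z : R).

Lemma gpoly_cvg0 k (a c : 'I_k.+1 -> R) : increasing_exp a -> a ord0 = 0 ->
  gpoly a c t @[t --> 0^'+] --> c ord0.
Proof.
move=> ai a0.
have -> : c ord0 = \sum_(i < k.+1) c i * (i == ord0)%:R.
  rewrite (bigD1 ord0)//= mulr1 big1 ?addr0// => i /negbTE ->.
  by rewrite mulr0.
apply: cvg_big => [|i _]; first exact: add_continuous.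
apply: cvgM; first exact: cvg_cst.
have [->|i0] := eqVneq i ord0.
  under eq_fun do rewrite a0 powRr0; exact: cvg_cst.
apply: powR_cvg0; rewrite -a0; apply: ai.
by rewrite lt0n; apply: contraNneq i0 => i0; apply/eqP/val_inj.
Qed.

(** Near 0 the lowest power dominates all the others. *)
Lemma gpoly_gt0_near0 k (a c : 'I_k.+1 -> R) t : increasing_exp a ->
  0 < c ord0 -> 0 < t -> exists e, [/\ 0 < e, e <= t & 0 < gpoly a c e].
Proof.
move=> ai c0 t0.
have ai' : increasing_exp (fun i => a i + - a ord0) by move=> i j ij; rewrite ltrD2r ai.
have := gpoly_cvg0 (c := c) ai' (subrr _).
move/cvgr_gt => /(_ _ c0) [d d0 /= dP].
exists (Num.min t (d / 2)).
have m0 : 0 < Num.min t (d / 2) by rewrite lt_min t0 divr_gt0.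
split => //; first by rewrite ge_min lexx.
have : 0 < gpoly (fun i => a i + - a ord0) c (Num.min t (d / 2)).
  apply: dP => //=; rewrite sub0r normrN gtr0_norm// gt_min.
  by apply/orP; right; rewrite ltr_pdivrMr// ltr_pMr// ltr1n.
by rewrite gpolyM// pmulr_rgt0// powR_gt0.
Qed.

Lemma row_det_neq0 k (a : 'I_k -> R) ns : increasing_exp a ->
  path <%R 0 (map (@pt R) ns) -> size (rows ns) = k ->
  row_det (powers a) (rows ns) != 0.
Proof.
move=> ai pos sz; rewrite /row_det -det_tr; apply/det0P => -[v v0 vM].
move/eqP: v0; apply; apply/rowP => i; rewrite mxE.
apply: (gpoly_zeros ai pos sz (c := v 0)) => {}i.
case: (ltnP i k) => [ik|ki]; last by rewrite /nth_row nth_default// sz.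
move/rowP/(_ (Ordinal ik)): vM; rewrite !mxE => <-.
by rewrite rows_gpoly//; apply: eq_bigr => j _; rewrite !mxE.
Qed.

Lemma gpoly_cofactors k (a cof : 'I_k -> R) p i : 0 < pt p ->
  nth_row (node_rows p) i (gpoly a cof) =
  \sum_(j < k) nth_row (node_rows p) i (powers a j) * cof j.
Proof.
move=> p0; have -> : node_rows p = rows [:: p] by rewrite /rows /= cats0.
by rewrite rows_gpoly/= ?p0//; apply: eq_bigr => j _; rewrite mulrC.
Qed.

Lemma derive1_ge0_right (f : R -> R) x d : derivable f x 1 -> 0 < d -> f x = 0 ->
  (forall t, x < t < x + d -> 0 <= f t) -> 0 <= derive1 f x.
Proof.
move=> df d0 fx fge; rewrite derive1E ['D_1 f x]cvg_at_rightE; last exact: df.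
apply: limr_ge.
  rewrite -(cvg_at_rightE (fun h : R => h^-1 *: ((f \o shift x) _ - f x))) //.
  apply: cvg_trans df; apply: cvg_app.
  move=> A [e egt0 Ae]; exists e => // y xe xgt0; apply: Ae => //.
  exact/lt0r_neq0.
near=> h; apply: mulr_ge0.
  by rewrite invr_ge0; apply: ltW; near: h; exists 1 => /=.
rewrite fx subr0 [_%:A]mulr1; apply: fge; rewrite /= ltrDr addrC ltrD2l.
apply/andP; split; near: h; first by exists 1 => /=.
by exists d => //= h; rewrite /= sub0r normrN => /(le_lt_trans (ler_norm _)).
Unshelve. all: by end_near. Qed.

Definition node_coef k (a : 'I_k.+1 -> R) ns : 'I_k.+1 -> R :=
  cofactor (row_mx_of (powers a) ((fun=> 0 : R) :: rows ns)) ord0.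

Lemma node_polyE k (a : 'I_k.+1 -> R) ns t :
  row_det (powers a) (rows (Single t :: ns)) = gpoly a (node_coef a ns) t.
Proof.
rewrite [LHS](@row_det_expand _ _ _ [::] _ ord0)//.
by apply: eq_bigr => j _; rewrite mulrC.
Qed.

(** The lowest coefficient is again a node determinant, with one function and
    one row less: this is what drives the induction in [row_det_gt0]. *)
Lemma node_coef0 k (a : 'I_k.+1 -> R) ns :
  node_coef a ns ord0 = row_det (powers (fun i => a (lift ord0 i))) (rows ns).
Proof.
rewrite /node_coef /cofactor /= mul1r; congr (\det _).
by apply/matrixP => x y; rewrite !mxE.
Qed.

(** Total positivity of the powers on the positive half-line, by induction on
    the number of functions.  When the first node is a plain point, the
    determinant as a function of that point is positive near 0, since its
    lowest coefficient is a smaller determinant, and it cannot vanish before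
    the next node.  A double first node is the limit of two plain points that
    merge, so its determinant is a right derivative of positive values at a
    zero; it is therefore nonnegative, and it is not 0 by [row_det_neq0]. *)
Lemma row_det_gt0 k (a : 'I_k -> R) ns : increasing_exp a ->
  path <%R 0 (map (@pt R) ns) -> size (rows ns) = k ->
  0 < row_det (powers a) (rows ns).
Proof.
elim: k a ns => [|k IH] a ns ai pos sz; first by rewrite /row_det det_mx00.
have ai1 : increasing_exp (fun i => a (lift ord0 i)) by move=> i j ij; apply: ai.
have single z l : path <%R 0 (z :: map (@pt R) l) -> size (rows l) = k ->
    0 < row_det (powers a) (rows (Single z :: l)).
  move=> /= /andP[z0 zl] szl.
  have c0 : 0 < node_coef a l ord0.
    by rewrite node_coef0 IH//; exact: (path_le lt_trans z0 zl).
  have [e [e0 ez pe]] := gpoly_gt0_near0 ai c0 z0.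
  rewrite node_polyE ltNge; apply/negP => pz.
  have cont : {within `[e, z], continuous (gpoly a (node_coef a l))}.
    apply: derivable_within_continuous => x; rewrite in_itv /= => /andP[ex _].
    by have ? := is_derive_gpoly a (node_coef a l) (lt_le_trans e0 ex); exact: ex_derive.
  have [|y yez py] := IVT (v := 0) ez cont.
    by rewrite ge_min pz orbT /= le_max (ltW pe).
  move: yez; rewrite in_itv /= => /andP[ey yz].
  have y0 := lt_le_trans e0 ey.
  have := @row_det_neq0 _ a (Single y :: l) ai; rewrite node_polyE py eqxx => /(_ _ _)/negP.
  apply => //; rewrite /= ?y0.
    by move: yz; rewrite le_eqVlt => /orP[/eqP->//|yz]; exact: (path_le lt_trans) zl.
  by rewrite /rows /= -/(rows l) szl.
(* The first node is now either plain, which is [single], or double. *)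
case: ns pos sz => [//|[z|z] ns] pos sz.
  by apply: single => //; case: sz.
case: k {IH ai1} a ai sz single => [|k] a ai sz single.
  by [].
move: pos => /= /andP[z0 zns].
have szns : size (rows ns) = k by case: sz.
pose c := cofactor (row_mx_of (powers a) ((fun g => g z) :: (fun=> 0 : R) :: rows ns))
  (lift ord0 ord0).
have E r : row_det (powers a) ((fun g => g z) :: r :: rows ns) =
    \sum_(j < k.+2) r (powers a j) * c j.
  by rewrite [LHS](@row_det_expand _ _ _ [:: fun g => g z] _ (lift ord0 ord0)).
(* Two plain points z < t, as t decreases to z. *)
have Eq t : row_det (powers a) ((fun g => g z) :: (fun g => g t) :: rows ns) = gpoly a c t.
  by rewrite E; apply: eq_bigr => j _; rewrite mulrC.
have Ed : row_det (powers a) (rows (Double z :: ns)) = derive1 (gpoly a c) z.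
  rewrite [LHS]E; exact: esym (@gpoly_cofactors _ a c (Double z) 1%N z0).
rewrite lt_neqAle eq_sym row_det_neq0 //=; last by rewrite /= z0.
rewrite Ed.
have [d d0 dns] : exists2 d, 0 < d & forall t, z < t < z + d -> path <%R t (map (@pt R) ns).
  case: (ns) zns => [|q l] /=; first by exists 1.
  move=> /andP[zq ql]; exists (pt q - z); first by rewrite subr_gt0.
  by move=> t /andP[zt]; rewrite addrC subrK => ->.
apply: (derive1_ge0_right _ d0).
- by have ? := is_derive_gpoly a c z0; exact: ex_derive.
- rewrite -Eq; apply: (@row_det_dup _ _ _ _ [::]) => //.
- move=> t td; rewrite -Eq; apply: ltW; apply: (single z (Single t :: ns)) => /=.
    by rewrite z0 dns// andbT; case/andP: td.
  by rewrite /rows /= -/(rows ns) szns.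
Qed.

End PositiveDeterminants.

(** * Signs of the node polynomials *)

Section NodePolynomials.
Variable R : realType.
Implicit Types (ns : seq (node R)) (t z b : R) (xs : seq R).

Definition node_poly k (a : 'I_k.+1 -> R) ns : R -> R := gpoly a (node_coef a ns).

Definition below t ns := [seq p <- ns | pt p < t].

Lemma rows_cat ns1 ns2 : rows (ns1 ++ ns2) = rows ns1 ++ rows ns2.
Proof. by rewrite /rows map_cat flatten_cat. Qed.

Lemma cat_below t ns : sorted <%R (map (@pt R) ns) ->
  ns = below t ns ++ [seq p <- ns | ~~ (pt p < t)].
Proof.
elim: ns => [//|p ns IH] /= so.
case: ifPn => pt_t /=; first by rewrite -IH//; exact: path_sorted so.
have ge : all (fun q => ~~ (pt q < t)) ns.
  have := order_path_min lt_trans so; rewrite all_map; apply: sub_all => q /= pq.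
  by rewrite -leNgt (le_trans _ (ltW pq))// leNgt.
have -> : below t ns = [::].
  by apply: size0nil; rewrite size_filter; apply/eqP;
     rewrite -leqn0 leqNgt -has_count -all_predC.
by rewrite (all_filterP ge).
Qed.

Lemma path_insert t s : path <%R 0 s -> 0 < t -> t \notin s ->
  path <%R 0 ([seq x <- s | x < t] ++ t :: [seq x <- s | ~~ (x < t)]).
Proof.
move=> so t0 ts; rewrite cat_path path_filter//=; last exact: lt_trans.
apply/andP; split.
  have := mem_last 0 [seq x <- s | x < t]; rewrite inE => /orP[/eqP->//|].
  by rewrite mem_filter => /andP[].
rewrite (path_sortedE lt_trans) sorted_filter ?(path_sorted so)//; last exact: lt_trans.
rewrite andbT; apply/allP => x; rewrite mem_filter -leNgt => /andP[tx xs].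
by rewrite lt_neqAle tx andbT; apply: contraNneq ts => ->.
Qed.

(** Putting the row of [t] in its place costs one transposition for each row
    below it and leads to a positive determinant. *)
Lemma node_poly_sign k (a : 'I_k.+1 -> R) ns t : increasing_exp a ->
  path <%R 0 (map (@pt R) ns) -> size (rows ns) = k -> 0 < t ->
  t \notin map (@pt R) ns ->
  0 < (-1) ^+ size (rows (below t ns)) * node_poly a ns t.
Proof.
move=> ai pos sz t0 tns.
have E := cat_below t (path_sorted pos).
set ns2 := [seq _ <- _ | _] in E.
have szE : (size (rows (below t ns)) + size (rows ns2))%N = k.
  by rewrite -size_cat -rows_cat -E.
rewrite /node_poly -node_polyE [X in Single t :: X]E.
have -> : rows (Single t :: below t ns ++ ns2) =
    [::] ++ (fun g => g t) :: rows (below t ns) ++ rows ns2 by rewrite -rows_cat.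
rewrite row_det_insert /=; last by rewrite add0n ltnS -szE leq_addr.
rewrite mulrA -expr2 sqrr_sign mul1r.
have -> : rows (below t ns) ++ (fun g => g t) :: rows ns2 =
  rows (below t ns ++ Single t :: ns2) by rewrite rows_cat.
apply: row_det_gt0 => //; last by rewrite rows_cat size_cat /= addnS szE.
by rewrite map_cat /=; have := path_insert pos t0 tns; rewrite !filter_map.
Qed.

Lemma node_poly_root k (a : 'I_k.+1 -> R) ns t : size (rows ns) = k ->
  t \in map (@pt R) ns -> node_poly a ns t = 0.
Proof.
move=> sz tns.
have [ns1 [p [ns2 [E pt_t]]]] : exists ns1 p ns2, ns = ns1 ++ p :: ns2 /\ pt p = t.
  elim: ns tns {sz} => [//|q l IH]; rewrite inE => /orP[/eqP ->|/IH].
    by exists [::], q, l.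
  by move=> [l1 [p [l2 [-> pt_t]]]]; exists (q :: l1), p, l2.
rewrite /node_poly -node_polyE E.
have [r' Er] : exists r', rows ns = rows ns1 ++ (fun g => g t) :: r'.
  by rewrite E rows_cat; case: p pt_t {E} => z /= ->; eexists; rewrite /rows /=.
rewrite -E [rows _]/= {1}/rows /= -/(rows ns) Er.
apply: row_det_dup; rewrite ltnS -sz Er size_cat /= addnS ltnS.
by rewrite leq_addr.
Qed.

Lemma node_poly0_gt0 k (a : 'I_k.+1 -> R) ns : increasing_exp a -> a ord0 = 0 ->
  path <%R 0 (map (@pt R) ns) -> size (rows ns) = k -> 0 < node_poly a ns 0.
Proof.
move=> ai a0 pos sz.
rewrite /node_poly /gpoly big_ord_recl a0 powRr0 mulr1 big1 ?addr0.
  by rewrite node_coef0 row_det_gt0// => i j ij; apply: ai.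
move=> i _; rewrite powR0 ?mulr0// gt_eqF// -a0; exact: ai.
Qed.

Lemma node_poly_ge0 k (a : 'I_k.+1 -> R) ns t : increasing_exp a -> 0 <= a ord0 ->
  path <%R 0 (map (@pt R) ns) -> size (rows ns) = k -> 0 <= t ->
  ~~ odd (size (rows (below t ns))) -> 0 <= node_poly a ns t.
Proof.
move=> ai a0 pos sz; rewrite le_eqVlt => /orP[/eqP <- _|t0 ev].
  move: a0; rewrite le_eqVlt => /orP[/eqP/esym a0|a0].
    by apply/ltW/node_poly0_gt0.
  rewrite /node_poly /gpoly big1// => i _; rewrite powR0 ?mulr0// gt_eqF//.
  by case: (unliftP ord0 i) => [j ->|->//]; apply: lt_trans a0 _; exact: ai.
have [tns|tns] := boolP (t \in map (@pt R) ns); first by rewrite node_poly_root.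
have := node_poly_sign ai pos sz t0 tns.
by rewrite -signr_odd (negbTE ev) mul1r => /ltW.
Qed.

(** The point that normalises a multiple of a node polynomial in
    [multiple_of_node_poly]. *)
Lemma node_poly_gt0_near0 k (a : 'I_k.+1 -> R) ns b : increasing_exp a ->
  path <%R 0 (map (@pt R) ns) -> size (rows ns) = k -> 0 < b ->
  exists t, [/\ 0 < t, t <= b & 0 < node_poly a ns t].
Proof.
move=> ai pos sz b0; apply: gpoly_gt0_near0 => //.
by rewrite node_coef0 row_det_gt0// => i j ij; apply: ai.
Qed.

Lemma size_rows_Double xs : size (rows [seq Double z | z <- xs]) = (size xs).*2.
Proof. by elim: xs => //= z xs IH; rewrite /rows /= -/(rows _) IH. Qed.

Lemma pt_Double xs : map (@pt R) [seq Double z | z <- xs] = xs.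
Proof. by rewrite -map_comp map_id. Qed.

Lemma below_Double t xs :
  below t [seq Double z | z <- xs] = [seq Double z | z <- xs & z < t].
Proof. by rewrite /below filter_map. Qed.

Lemma below_rcons t b xs : t <= b ->
  below t (rcons [seq Double z | z <- xs] (Single b)) = [seq Double z | z <- xs & z < t].
Proof. by move=> tb; rewrite /below filter_rcons /= ltNge tb /= -below_Double. Qed.

Lemma below_Single t xs :
  below t [seq Single z | z <- xs] = [seq Single z | z <- xs & z < t].
Proof. by rewrite /below filter_map. Qed.

End NodePolynomials.

(** * Alternation, continuity and perturbation *)

Section Alternation.
Variable R : realType.
Implicit Types (A B S : set R) (a b c t : R).

Lemma closed_min S c : closed S -> S !=set0 -> (forall t, S t -> c <= t) ->
  exists m, S m /\ forall t, S t -> m <= t.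
Proof.
move=> clS [s Ss] Sc.
have K0 : (`[c, s] `&` S) !=set0 by exists s; split => //=; rewrite in_itv /= Sc/=.
have cK : compact (`[c, s] `&` S).
  by apply: compact_closedI => //; exact: segment_compact.
have [|m] := compact_EVT_min (f := id) K0 cK.
  by apply: continuous_subspaceT => x; exact: cvg_id.
rewrite inE => -[_ Sm] mP; exists m; split => // t St.
have [ts|st] := leP t s; first by apply: mP; rewrite inE; split => //=; rewrite in_itv /= Sc.
by apply: le_trans (ltW st); apply: mP; rewrite inE; split => //=; rewrite in_itv /= Sc/=.
Qed.

Lemma closed_gap A a c : closed A -> a < c -> ~ A c ->
  exists2 d, a < d < c & forall t, d <= t <= c -> ~ A t.
Proof.
move=> clA ac nAc.
have /nbhs_ballP[e /= e0 eP] : nbhs c (~` A).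
  by apply: open_nbhs_nbhs; split => //; rewrite openC.
exists (Num.max (c - e / 2) ((a + c) / 2)).
  rewrite lt_max [a < (a + c) / 2]midf_lt// orbT /= gt_max midf_lt// andbT.
  by rewrite gtrBl divr_gt0.
move=> t; rewrite ge_max => /andP[/andP[ect _] tc]; apply: eP.
rewrite /ball /= ger0_norm ?subr_ge0//.
have : e / 2 < e by rewrite ltr_pdivrMr// ltr_pMr// ltr1n.
by move: ect; lra.
Qed.

(** Greedy scan from [c] upwards: the least point of [B] starts the alternating
    sequence, the scan goes on from there with the roles of [A] and [B]
    exchanged, and a separating point fits in just before it because [A] is
    closed.  The scan ends when the set that is due next is exhausted. *)
Lemma alternation_or_separation k A B c : closed A -> closed B ->
  (forall t, A t -> ~ B t) -> ~ B c ->
  (exists s, [/\ size s = k, path <%R c s &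
     forall i, (i < k)%N -> (if odd i then A else B) (nth 0 s i)]) \/
  (exists ys, [/\ (size ys < k)%N, path <%R c ys,
     (forall t, c <= t -> A t -> t \notin ys /\ ~~ odd (count (< t) ys)) &
     (forall t, c <= t -> B t -> t \notin ys /\ odd (count (< t) ys))]).
Proof.
elim: k A B c => [|k IH] A B c clA clB AB nBc; first by left; exists [::].
have [[t [ct Bt]]|noB] := pselect (exists t, c <= t /\ B t); last first.
  by right; exists [::]; split => // t ct Bt; case: noB; exists t.
have [t0 [[ct0 Bt0] t0min]] : exists m, (`[c, +oo[ `&` B) m /\
    forall t, (`[c, +oo[ `&` B) t -> m <= t.
  apply: (closed_min (c := c)).
  - apply: closedI => //; exact: rray_closed.
  - by exists t; split => //=; rewrite in_itv /= ct.
  - by move=> x [/=]; rewrite in_itv /= andbT.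
move: ct0; rewrite /= in_itv /= andbT => ct0.
have {}ct0 : c < t0 by rewrite lt_neqAle ct0 andbT; apply: contra_notN nBc => /eqP ->.
have nAt0 : ~ A t0 by move/AB.
have [|[s [szs sos sP]]|[ys [szys soys ysB ysA]]] := IH B A t0 clB clA _ nAt0.
- by move=> x Bx Ax; exact: AB Ax Bx.
- left; exists (t0 :: s); split => //=; [by rewrite szs|by rewrite ct0|].
  by move=> [|i] //= ik; rewrite if_neg; exact: sP.
- right; have [d /andP[cd dt0] dA] := closed_gap clA ct0 nAt0.
  have all_d := order_path_min lt_trans soys.
  exists (d :: ys); split => //=.
  + by rewrite cd; exact: (path_le lt_trans) dt0 soys.
  + move=> x cx Ax; rewrite inE negb_or.
    have [t0x|xt0] := leP t0 x.
      have [xys cnt] := ysA _ t0x Ax; split.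
        by rewrite xys andbT gt_eqF// (lt_le_trans dt0).
      by rewrite (lt_le_trans dt0 t0x) /= negbK.
    have xd : x < d by rewrite ltNge; apply/negP => dx; apply: (dA x) => //; rewrite dx ltW.
    split; first by rewrite lt_eqF//=; apply/negP => /(allP all_d) /=; rewrite ltNge ltW.
    rewrite ltNge (ltW xd) /= add0n; suff -> : count (< x) ys = 0%N by [].
    apply/eqP; rewrite -leqn0 leqNgt -has_count; apply/hasPn => y /(allP all_d) /=.
    by rewrite -leNgt => /ltW; apply: le_trans; exact: ltW.
  + move=> x cx Bx; have t0x : t0 <= x by apply: t0min; split => //=; rewrite in_itv /= cx.
    have [xys cnt] := ysB _ t0x Bx; split.
      by rewrite inE negb_or xys andbT gt_eqF// (lt_le_trans dt0).
    by rewrite (lt_le_trans dt0 t0x) /=.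
Qed.

End Alternation.

Section Continuity.
Variable R : realType.

(** For [e > 0], [t `^ e] is 1 at negative [t], hence it jumps at 0; composing
    with the absolute value gives a function that agrees with it on [0, b]
    and is continuous everywhere. *)
Lemma powR_norm_continuous (e : R) : 0 <= e -> continuous (fun t : R => `|t| `^ e).
Proof.
rewrite le_eqVlt => /orP[/eqP <-|e0].
  by under eq_fun do rewrite powRr0; move=> t; exact: cvg_cst.
move=> t; have [->|t0] := eqVneq t 0.
  rewrite /continuous_at normr0 powR0 ?gt_eqF//; apply/cvgrPdist_lt => eps eps0.
  have /cvgrPdist_lt/(_ _ eps0)[d /= d0 dP] := powR_cvg0 e0.
  exists d => //= x /=; rewrite sub0r normrN => xd.
  have [->|x0] := eqVneq x 0; first by rewrite normr0 powR0 ?gt_eqF// subr0 normr0.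
  by apply: dP => /=; rewrite ?sub0r ?normrN ?normr_id// normr_gt0.
apply: (@continuous_comp _ _ _ (fun t : R => `|t|) (fun t => t `^ e)).
  exact: norm_continuous.
apply/differentiable_continuous/derivable1_diffP; apply: derivable_powR.
by rewrite in_itv /= andbT normr_gt0.
Qed.

Lemma gpoly_norm_continuous k (a c : 'I_k -> R) : (forall i, 0 <= a i) ->
  continuous (fun t : R => gpoly a c `|t|).
Proof.
move=> a0 t; apply: cvg_big => [|i _]; first exact: add_continuous.
by apply: cvgM; [exact: cvg_cst|exact: powR_norm_continuous].
Qed.

Lemma gpoly_continuous_coef k (a : 'I_k -> R) t :
  continuous (fun v : 'rV[R]_k => gpoly a (v ord0) t).
Proof.
move=> v; have FF : Filter (nbhs v) by exact: nbhs_filter.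
apply: (cvg_big _ FF) => [|i _]; first exact: add_continuous.
by apply: cvgM; [exact: (@coord_continuous _ _ _ ord0 i v)|exact: cvg_cst].
Qed.

(** By compactness [u] or [h] is bounded below by a positive constant at each
    point: where [u] is, a small multiple of [h] does no harm, and elsewhere
    [h] is positive. *)
Lemma perturb_nonneg (u h : R -> R) b : continuous u -> continuous h ->
  (forall t, t \in `[0, b] -> 0 <= u t) ->
  (forall t, t \in `[0, b] -> u t = 0 -> 0 < h t) -> 0 < b ->
  exists2 e, 0 < e & forall d t, 0 < d <= e -> t \in `[0, b] -> 0 <= u t + d * h t.
Proof.
move=> cu ch u0 hu b0.
have [m mb mP] : exists2 m, m \in `[0, b] & forall t, t \in `[0, b] ->
    Num.max (u m) (h m) <= Num.max (u t) (h t).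
  apply: (@EVT_min _ (u \max h)); first exact: ltW.
  by apply: continuous_subspaceT => t; apply: continuous_max; [exact: cu|exact: ch].
have m0 : 0 < Num.max (u m) (h m).
  rewrite lt_max; have := u0 m mb; rewrite le_eqVlt => /orP[/eqP/esym um|->//].
  by rewrite (hu m) ?orbT.
have [M Mb MP] : exists2 M, M \in `[0, b] & forall t, t \in `[0, b] -> - h t <= - h M.
  apply: (@EVT_max _ (fun t => - h t)); first exact: ltW.
  by apply: continuous_subspaceT => t; apply: continuousN; exact: ch.
set eta := Num.max (u m) (h m) in m0 mP.
have K0 : 0 < `|h M| + 1 by rewrite ltr_wpDl.
exists (eta / (`|h M| + 1)); first exact: divr_gt0.
move=> d t /andP[d0]; rewrite ler_pdivlMr// => de tb.
have := mP _ tb; rewrite le_max => /orP[ut|ht]; last first.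
  by rewrite addr_ge0 ?u0// mulr_ge0 ?ltW// (lt_le_trans m0).
have hM : - h t <= `|h M| by rewrite (le_trans (MP _ tb))// -normrN ler_norm.
have : d * (- h t) <= d * `|h M| by rewrite ler_wpM2l// ltW.
by move: de ut d0; rewrite /eta; nra.
Qed.

End Continuity.

(** * Positive generalized polynomials split into two extremal ones *)

Section Snake.
Variables (R : realType) (n : nat) (a : 'I_n.+1 -> R) (b : R).
Hypotheses (ai : increasing_exp a) (a0 : a ord0 = 0) (b0 : 0 < b).
Implicit Types (c d : 'I_n.+1 -> R) (t : R).

Lemma exp_ge0 i : 0 <= a i.
Proof.
by case: (unliftP ord0 i) => [j ->|->]; rewrite -?a0// ltW// a0 -a0; exact: ai.
Qed.

Lemma gpolyD c d e t : gpoly a (fun i => c i + e * d i) t = gpoly a c t + e * gpoly a d t.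
Proof.
by rewrite /gpoly big_distrr -big_split; apply: eq_bigr => i _ /=; rewrite mulrDl mulrA.
Qed.

Lemma gpolyN d t : gpoly a (fun i => - d i) t = - gpoly a d t.
Proof. by rewrite /gpoly -sumrN; apply: eq_bigr => i _; rewrite mulNr. Qed.

(** The node polynomial with simple zeros at [ys]; the zeros that are missing
    from the full number [n] are placed beyond [B]. *)
Lemma separating_gpoly B ys : 0 < B -> path <%R 0 ys -> (size ys <= n)%N ->
  exists c, forall t, 0 <= t <= B -> t \notin ys ->
    0 < (-1) ^+ count (< t) ys * gpoly a c t.
Proof.
move=> B0 soys szys.
(* Starting beyond ys as well as B keeps the list of zeros increasing. *)
pose e := Num.max B (last 0 ys).
pose pad := [seq e + i.+1%:R | i <- iota 0 (n - size ys)].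
pose zs := ys ++ pad.
have padP : path <%R (last 0 ys) pad.
  rewrite (path_sortedE lt_trans); apply/andP; split.
    apply/allP => y /mapP[i _ ->]; rewrite ltr_pwDr ?ltr0n//.
    by rewrite /e le_max lexx orbT.
  rewrite sorted_map; apply: sub_sorted (iota_ltn_sorted 0 _) => i j ij /=.
  by rewrite ltrD2l ltr_nat.
have padB t : t <= B -> all (fun y => t < y) pad.
  move=> tB; apply/allP => y /mapP[i _ ->]; rewrite ltr_pwDr ?ltr0n//.
  by rewrite /e le_max tB.
have soz : path <%R 0 zs by rewrite cat_path soys.
have szz : size (rows [seq Single z | z <- zs]) = n.
  by rewrite size_rows_Single size_cat size_map size_iota subnKC.
exists (node_coef a [seq Single z | z <- zs]) => t /andP[t0 tB] tys.
have cnt : count (< t) zs = count (< t) ys.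
  rewrite count_cat [X in (_ + X)%N](_ : _ = 0%N) ?addn0//.
  apply/eqP; rewrite -leqn0 leqNgt -has_count; apply/hasPn => y /(allP (padB _ tB)) ty.
  by rewrite -leNgt ltW.
rewrite -cnt; move: t0; rewrite le_eqVlt => /orP[/eqP <-|t0].
  rewrite (_ : count _ zs = 0%N).
    by rewrite mul1r node_poly0_gt0// pt_Single.
  apply/eqP; rewrite -leqn0 leqNgt -has_count; apply/hasPn => y.
  by move=> /(allP (order_path_min lt_trans soz)) /= y0; rewrite -leNgt ltW.
have := @node_poly_sign _ _ a [seq Single z | z <- zs] t ai.
rewrite below_Single size_rows_Single size_filter; apply => //; rewrite pt_Single//.
by rewrite mem_cat negb_or tys; apply/negP => /(allP (padB _ tB)); rewrite ltxx.
Qed.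

(** The values at [n.+1] points of [0, b] determine the coefficients
    linearly, so bounded values give bounded coefficients. *)
Lemma between_compact d : compact
  [set v : 'rV[R]_n.+1 | forall t, t \in `[0, b] ->
     0 <= gpoly a (v ord0) t /\ 0 <= gpoly a d t - gpoly a (v ord0) t].
Proof.
pose z (i : nat) := b * (i.+1%:R / n.+1%:R).
pose ns := [seq Single x | x <- mkseq z n.+1].
have zb (i : 'I_n.+1) : z i \in `[0, b].
  rewrite in_itv /= mulr_ge0 ?divr_ge0 ?ler0n ?(ltW b0)//= ler_piMr ?(ltW b0)//.
  by rewrite ler_pdivrMr ?ltr0n// mul1r ler_nat.
have pos : path <%R 0 (map (@pt R) ns).
  rewrite pt_Single (path_sortedE lt_trans); apply/andP; split.
    by apply/allP => y /mapP[i _ ->] /=; rewrite mulr_gt0// divr_gt0// ltr0n.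
  rewrite sorted_map; apply: sub_sorted (iota_ltn_sorted 0 _) => i j ij /=.
  by rewrite ltr_pM2l// ltr_pM2r ?invr_gt0 ?ltr0n// ltr_nat.
have szr : size (rows ns) = n.+1 by rewrite size_rows_Single size_mkseq.
set M := row_mx_of (powers a) (rows ns).
have Mu : M \in unitmx by rewrite unitmxE unitfE; exact: row_det_neq0.
pose K i := \sum_j `|invmx M i j| * gpoly a d (z j).
have sub : [set v : 'rV[R]_n.+1 | forall t, t \in `[0, b] ->
     0 <= gpoly a (v ord0) t /\ 0 <= gpoly a d t - gpoly a (v ord0) t] `<=`
   [set v : 'rV[R]_n.+1 | forall i, [set` `[- K i, K i]] (v ord0 i)].
  move=> v vP i; have Mv j : (M *m v^T) j ord0 = gpoly a (v ord0) (z j).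
    rewrite mxE; apply: eq_bigr => l _; rewrite !mxE mulrC; congr (_ * _).
    by rewrite nth_row_Single ?size_mkseq// nth_mkseq.
  have -> : v ord0 i = \sum_j invmx M i j * gpoly a (v ord0) (z j).
    have : (invmx M *m (M *m v^T)) i ord0 = v ord0 i by rewrite mulKmx// mxE.
    by move=> <-; rewrite mxE; apply: eq_bigr => j _; rewrite Mv.
  rewrite /= in_itv /= -ler_norml; apply: le_trans (ler_norm_sum _ _ _) _.
  apply: ler_sum => j _; rewrite normrM ler_wpM2l//.
  by have [v0 vd] := vP _ (zb j); rewrite ger0_norm// -subr_ge0.
apply: subclosed_compact sub; last first.
  by apply: (@rV_compact _ _ (fun i => [set` `[- K i, K i]])) => i; exact: segment_compact.
rewrite (_ : [set _ | _] = \bigcap_(t in [set` `[0, b]])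
  ((fun v : 'rV[R]_n.+1 => gpoly a (v ord0) t) @^-1` [set x | 0 <= x] `&`
  (fun v : 'rV[R]_n.+1 => gpoly a (v ord0) t) @^-1` [set x | x <= gpoly a d t])); last first.
  by apply/seteqP; split => v vP t tb; have := vP t tb; rewrite /= subr_ge0.
apply: closed_bigI => t _; apply: closedI; apply: preimage_closed;
  try by move=> v _; exact: gpoly_continuous_coef.
- exact: closed_ge.
- exact: closed_le.
Qed.

Lemma closed_gpoly_zeros c : closed [set t | t \in `[0, b] /\ gpoly a c t = 0].
Proof.
rewrite (_ : [set _ | _] = `[0, b] `&`
    (fun t : R => gpoly a c `|t|) @^-1` [set x | x = 0]).
  apply: closedI; first exact: itv_closed.
  apply: preimage_closed; last exact: closed_eq.
  by move=> t _; exact: (gpoly_norm_continuous exp_ge0).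
apply/seteqP; split => t /= [tb]; have t0 : 0 <= t by move: tb; rewrite in_itv => /andP[].
  by rewrite ger0_norm.
by rewrite ger0_norm.
Qed.

Lemma perturb_gpoly c d : (forall t, t \in `[0, b] -> 0 <= gpoly a c t) ->
  (forall t, t \in `[0, b] -> gpoly a c t = 0 -> 0 < gpoly a d t) ->
  exists2 e0, 0 < e0 & forall e t, 0 < e <= e0 -> t \in `[0, b] ->
    0 <= gpoly a c t + e * gpoly a d t.
Proof.
move=> c0 cd; have normb t : t \in `[0, b] -> `|t| = t.
  by rewrite in_itv /= => /andP[t0 _]; rewrite ger0_norm.
have [|||e0 e00 eP] := perturb_nonneg (gpoly_norm_continuous (c := c) exp_ge0)
  (gpoly_norm_continuous (c := d) exp_ge0) (b := b) _ _ _ => //.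
- by move=> t tb; rewrite normb// c0.
- by move=> t tb; rewrite normb//; exact: cd.
by exists e0 => // e t ee tb; have := eP e t ee tb; rewrite normb.
Qed.

(** The decomposition of Karlin and Shapley.  The maximiser of the value at a
    point [B] beyond [b] has the required alternation, since otherwise the
    polynomial of [separating_gpoly] improves it; counting [B] among the
    contacts with 0 ensures that the improvement increases the value there. *)
Lemma snake d : (forall t, t \in `[0, b] -> 0 < gpoly a d t) ->
  exists c1 c2 (t : nat -> R),
    [/\ forall x, x \in `[0, b] -> 0 <= gpoly a c1 x,
        forall x, x \in `[0, b] -> 0 <= gpoly a c2 x,
        forall i, c1 i + c2 i = d i &
        [/\ 0 <= t 0%N, t n <= b, forall i, (i < n)%N -> t i < t i.+1 &
         forall i, (i <= n)%N -> gpoly a (if odd i then c2 else c1) (t i) = 0]].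
Proof.
move=> d0; pose B := b + 1.
have bB : b < B by rewrite ltrDl.
have B0 : 0 < B := lt_trans b0 bB.
pose S := [set v : 'rV[R]_n.+1 | forall t, t \in `[0, b] ->
  0 <= gpoly a (v ord0) t /\ 0 <= gpoly a d t - gpoly a (v ord0) t].
have S0 : S !=set0.
  exists 0 => t tb; have -> : gpoly a ((0 : 'rV[R]_n.+1) ord0) t = 0.
    by apply: big1 => i _; rewrite mxE mul0r.
  by rewrite subr0; split => //; exact: ltW (d0 t tb).
have [v] := EVT_max_rV (f := fun v : 'rV[R]_n.+1 => gpoly a (v ord0) B) S0
  (between_compact (d := d)) (continuous_subspaceT (gpoly_continuous_coef (a := a) (t := B))).
rewrite inE => Sv vmax.
pose c := v ord0; pose c' i := d i + (-1) * c i.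
have c'E t : gpoly a c' t = gpoly a d t - gpoly a c t by rewrite gpolyD mulN1r.
have cge t : t \in `[0, b] -> 0 <= gpoly a c t by move=> /Sv[].
have c'ge t : t \in `[0, b] -> 0 <= gpoly a c' t by rewrite c'E => /Sv[].
(* Contacts of the optimum c with 0 and with d; the point B counts as one of
   the former. *)
pose X := [set t | t \in `[0, b] /\ gpoly a c t = 0] `|` [set B].
pose Y := [set t | t \in `[0, b] /\ gpoly a c' t = 0].
have clX : closed X by apply: closedU; [exact: closed_gpoly_zeros|exact: closed_eq].
have clY : closed Y by exact: closed_gpoly_zeros.
have Bnb : B \notin `[0, b] by rewrite in_itv /= negb_and -!ltNge bB orbT.
have XY t : X t -> ~ Y t.
  move=> [[tb ct] [_]|-> [Bb _]]; last by rewrite Bb in Bnb.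
  by rewrite c'E ct subr0 => dt; have := d0 t tb; rewrite dt ltxx.
have XYB t : X t \/ Y t -> 0 <= t <= B.
  have bP s : s \in `[0, b] -> 0 <= s <= B.
    by rewrite in_itv /= => /andP[-> /le_trans-> //]; exact: ltW.
  by move=> [[[tb _]|->]|[tb _]]; [exact: bP|rewrite lexx ltW|exact: bP].
(* The sign sg decides which of the two kinds of contact comes first. *)
have no_sep (sg : R) (ys : seq R) : path <%R 0 ys -> (size ys <= n)%N ->
    (forall t, X t -> t \notin ys /\ 0 < sg * (-1) ^+ count (< t) ys) ->
    (forall t, Y t -> t \notin ys /\ sg * (-1) ^+ count (< t) ys < 0) -> False.
  move=> soys szys Xys Yys.
  have [h hP] := separating_gpoly B0 soys szys.
  pose w i := sg * h i.
  have wE t : gpoly a w t = sg * gpoly a h t.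
    by rewrite /gpoly big_distrr; apply: eq_bigr => i _ /=; rewrite mulrA.
  have wX t : X t -> 0 < gpoly a w t.
    move=> Xt; have [tys sgt] := Xys _ Xt; have := hP t (XYB _ (or_introl Xt)) tys.
    move=> /(mulr_gt0 sgt); rewrite wE -mulrA [_ ^+ _ * (_ * _)]mulrA -expr2.
    by rewrite sqrr_sign mul1r.
  have wY t : Y t -> gpoly a w t < 0.
    move=> Yt; have [tys sgt] := Yys _ Yt; have := hP t (XYB _ (or_intror Yt)) tys.
    rewrite -(nmulr_rlt0 _ sgt) wE -mulrA [_ ^+ _ * (_ * _)]mulrA -expr2.
    by rewrite sqrr_sign mul1r.
  have [e1 e10 e1P] := perturb_gpoly (d := w) cge (fun t tb ct => wX t (or_introl (conj tb ct))).
  have [|e2 e20 e2P] := perturb_gpoly (d := fun i => - w i) c'ge.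
    by move=> t tb ct; rewrite gpolyN oppr_gt0; apply: wY.
  pose e := Num.min e1 e2; have e0 : 0 < e by rewrite lt_min e10.
  pose v' : 'rV[R]_n.+1 := \row_i (c i + e * w i).
  have v'E t : gpoly a (v' ord0) t = gpoly a c t + e * gpoly a w t.
    by rewrite -gpolyD; apply: eq_bigr => i _; rewrite mxE.
  have Sv' : S v'.
    move=> t tb; rewrite v'E; split; first by rewrite e1P// e0 ge_min lexx.
    have := e2P e t; rewrite e0 ge_min lexx orbT /= gpolyN c'E => /(_ isT tb).
    by rewrite mulrN opprD addrA.
  have := vmax v'; rewrite inE => /(_ Sv'); rewrite v'E gerDl leNgt mulr_gt0//.
  by apply: wX; right.
have [t0 [XYt0 t0min]] : exists m, (X `|` Y) m /\ forall t, (X `|` Y) t -> m <= t.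
  apply: (closed_min (c := 0)); first exact: closedU.
    by exists B; left; right.
  by move=> t /XYB /andP[].
have t00 : 0 <= t0 by case/andP: (XYB _ XYt0).
have pos0 ys : path <%R t0 ys -> path <%R 0 ys.
  move: t00; rewrite le_eqVlt => /orP[/eqP->//|]; exact: (path_le lt_trans).
(* Only the last of the n + 2 alternation points can be B. *)
have fin s : size s = n.+1 -> path <%R t0 s ->
    (forall i, (i < n.+1)%N -> X (nth 0 s i) \/ Y (nth 0 s i)) ->
    let t := nth 0 (t0 :: s) in
    [/\ t n <= b, forall i, (i < n)%N -> t i < t i.+1 &
        forall i, (i <= n)%N -> (X (t i) -> gpoly a c (t i) = 0) /\
                                (Y (t i) -> gpoly a c' (t i) = 0)].
  move=> szs sos sXY t.
  have tXY i : (i <= n.+1)%N -> X (t i) \/ Y (t i) by case: i => [|i] //=; exact: sXY.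
  have tinc i : (i <= n)%N -> t i < t i.+1.
    by move=> ile; have /(pathP 0) := sos; apply; rewrite szs.
  have tB i : (i <= n)%N -> t i < B.
    move=> ile; apply: lt_le_trans (tinc i ile) _.
    by have /XYB/andP[] := tXY i.+1 ile.
  have tb i : (i <= n)%N -> t i \in `[0, b].
    move=> ile; case: (tXY i (leqW ile)) => [[[]//|tiB]|[]//].
    by have := tB i ile; rewrite tiB ltxx.
  split.
  - by have := tb n (leqnn n); rewrite in_itv => /andP[].
  - by move=> i /ltnW; exact: tinc.
  - move=> i ile; split; last by case.
    by case=> [[]//|tiB]; have := tB i ile; rewrite tiB ltxx.
have sgX m : ~~ odd m -> (-1) ^+ m = 1 :> R by rewrite -signr_odd => /negbTE ->.
have sgY m : odd m -> (-1) ^+ m = -1 :> R by rewrite -signr_odd => ->; rewrite expr1.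
case: XYt0 => XYt0.
- have [[s [szs sos sP]]|[ys [szys soys ysX ysY]]] :=
    alternation_or_separation n.+1 clX clY XY (XY _ XYt0).
  + have [|tn tinc tP] := fin s szs sos.
      by move=> i ile; have := sP i ile; case: odd; [left|right].
    exists c, c', (nth 0 (t0 :: s)); split => //.
      by move=> i; rewrite /c' mulN1r addrC subrK.
    split => // i ile; have [tX tY] := tP i ile.
    case: i ile tX tY => [|i] ile tX tY; first exact: tX.
    by have := sP i (leqW ile); rewrite /=; case: odd => /= ?; [exact: tX|exact: tY].
  + exfalso; apply: (no_sep 1 ys (pos0 _ soys) szys) => t Xt.
      by have [] := ysX t (t0min _ (or_introl Xt)) Xt; move=> ? /sgX ->; rewrite mulr1.
    by have [] := ysY t (t0min _ (or_intror Xt)) Xt; move=> ? /sgY ->; rewrite mul1r ltrN10.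
- have YX t : Y t -> ~ X t by move=> Yt /XY; apply.
  have [[s [szs sos sP]]|[ys [szys soys ysY ysX]]] :=
    alternation_or_separation n.+1 clY clX YX (YX _ XYt0).
  + have [|tn tinc tP] := fin s szs sos.
      by move=> i ile; have := sP i ile; case: odd; [right|left].
    exists c', c, (nth 0 (t0 :: s)); split => //.
      by move=> i; rewrite /c' mulN1r subrK.
    split => // i ile; have [tX tY] := tP i ile.
    case: i ile tX tY => [|i] ile tX tY; first exact: tY.
    by have := sP i (leqW ile); rewrite /=; case: odd => /= ?; [exact: tY|exact: tX].
  + exfalso; apply: (no_sep (-1) ys (pos0 _ soys) szys) => t Xt.
      by have [] := ysX t (t0min _ (or_introl Xt)) Xt; move=> ? /sgY ->; rewrite mulrNN mulr1.
    by have [] := ysY t (t0min _ (or_intror Xt)) Xt; move=> ? /sgX ->; rewrite mulr1 ltrN10.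
Qed.

End Snake.

(** * The cone generated by the moment curve *)

Section ConicHull.
Variable R : realType.

(** Caratheodory's reduction: subtract the multiple of a linear dependence
    between the rows at which a first weight reaches 0. *)
Lemma drop_atom k (s : 'M[R]_(k.+1, k)) (lam : 'I_k.+1 -> R) :
  (forall j, 0 <= lam j) ->
  exists lam' j0, [/\ forall j, 0 <= lam' j, lam' j0 = 0 &
    forall i, \sum_j lam' j * s j i = \sum_j lam j * s j i].
Proof.
move=> lam0.
have [mu mus [j1 mu1]] : exists2 mu : 'rV[R]_k.+1, mu *m s = 0 & exists j, 0 < mu ord0 j.
  have : kermx s != 0.
    by rewrite -mxrank_eq0 mxrank_ker -lt0n subn_gt0 ltnS rank_leq_col.
  case/rowV0Pn => u /sub_kermxP us /rV0Pn[j uj].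
  have [uj0|uj0] := ltP 0 (u ord0 j); first by exists u => //; exists j.
  exists (- u); first by rewrite mulNmx us oppr0.
  by exists j; rewrite mxE oppr_gt0 lt_neqAle uj.
have [j0 mu0 minj0] := @Order.TotalTheory.arg_minP _ _ _ j1
  (fun j => 0 < mu ord0 j) (fun j => lam j / mu ord0 j) mu1.
(* The first weight to vanish is the one with the least ratio. *)
pose r := lam j0 / mu ord0 j0.
have r0 : 0 <= r by rewrite divr_ge0// ltW.
exists (fun j => lam j - r * mu ord0 j), j0; split.
- move=> j; rewrite subr_ge0; have [muj|muj] := ltP 0 (mu ord0 j).
    by rewrite -ler_pdivlMr//; exact: minj0.
  by apply: le_trans (lam0 j); rewrite mulr_ge0_le0.
- by rewrite /r divfK ?subrr// gt_eqF.
- move=> i; have /rowP/(_ i) := mus; rewrite !mxE => musi.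
  under eq_bigr do rewrite mulrBl -mulrA; rewrite sumrB -big_distrr /= musi.
  by rewrite mulr0 subr0.
Qed.

(** The first-order condition at the endpoint of an interval. *)
Lemma first_order_ge0 (p q : R) :
  (forall e, 0 < e <= 1 -> 0 <= e * p + e ^+ 2 * q) -> 0 <= p.
Proof.
move=> pq; rewrite leNgt; apply/negP => p0.
have K0 : 0 < 2 * (`|q| + 1) by rewrite mulr_gt0// ltr_wpDl.
pose e := Num.min 1 (- p / (2 * (`|q| + 1))).
have e0 : 0 < e by rewrite lt_min ltr01 divr_gt0// oppr_gt0.
have e1 : e <= 1 by rewrite ge_min lexx.
have ep : e * (2 * (`|q| + 1)) <= - p.
  by rewrite -ler_pdivlMr// ge_min lexx orbT.
have := pq e; rewrite e0 e1 => /(_ isT).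
rewrite expr2 -mulrA -mulrDr pmulr_rge0//.
have : e * q <= e * `|q| by rewrite ler_wpM2l ?ler_norm// ltW.
by move: ep e0 p0; set x := `|q|; lra.
Qed.

Variables (k : nat) (a : 'I_k.+1 -> R) (b : R) (v : 'I_k.+1 -> R).
Hypotheses (ai : increasing_exp a) (a0 : a ord0 = 0) (b0 : 0 < b).

Let conic (lam x : 'I_k.+2 -> R) i := \sum_j lam j * x j `^ a i.
Let dist lam x := \sum_i (conic lam x i - v i) ^+ 2.
Let admissible (lam x : 'I_k.+2 -> R) :=
  (forall j, 0 <= lam j) /\ (forall j, x j \in `[0, b]).

(** Weights larger than some bound [Q] already make the value at the constant
    function too large, so the minimum may be sought on a compact set. *)
Lemma closest_conic : exists lam x, admissible lam x /\
  forall lam' x', admissible lam' x' -> dist lam x <= dist lam' x'.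
Proof.
pose V := \sum_i v i ^+ 2.
have V0 : 0 <= V by apply: sumr_ge0 => i _; exact: sqr_ge0.
pose Q := V + `|v ord0| + 1.
have Q0 : 0 <= Q by rewrite !addr_ge0.
pose T := [set l : 'rV[R]_k.+2 | forall j, [set` `[0, Q]] (l ord0 j)] `*`
          [set x : 'rV[R]_k.+2 | forall j, [set` `[0, b]] (x ord0 j)].
pose f (p : 'rV[R]_k.+2 * 'rV[R]_k.+2) := \sum_i
  (\sum_j p.1 ord0 j * `|p.2 ord0 j| `^ a i - v i) ^+ 2.
have cT : compact T.
  apply: compact_setX.
    by apply: (@rV_compact _ _ (fun=> [set` `[0, Q]])) => j; exact: segment_compact.
  by apply: (@rV_compact _ _ (fun=> [set` `[0, b]])) => j; exact: segment_compact.
have T0 : T (0, 0).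
  by split => j /=; rewrite mxE in_itv /= lexx ?(ltW b0) ?Q0.
have cf : continuous f.
  move=> p; have FF : Filter (nbhs p) by exact: nbhs_filter.
  apply: (cvg_big _ FF) => [|i _]; first exact: add_continuous.
  have cfi : (fun q : 'rV[R]_k.+2 * 'rV[R]_k.+2 =>
      \sum_j q.1 ord0 j * `|q.2 ord0 j| `^ a i - v i) @ p -->
      \sum_j p.1 ord0 j * `|p.2 ord0 j| `^ a i - v i.
    apply: cvgB; last exact: cvg_cst.
    apply: (cvg_big _ FF) => [|j _]; first exact: add_continuous.
    apply: cvgM.
      apply: (@continuous_comp _ _ _ fst (fun x : 'rV[R]_k.+2 => x ord0 j)).
        exact: cvg_fst.
      exact: (@coord_continuous _ _ _ ord0 j p.1).
    apply: (@continuous_comp _ _ _ snd (fun x : 'rV[R]_k.+2 => `|x ord0 j| `^ a i)).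
      exact: cvg_snd.
    apply: (@continuous_comp _ _ _ (fun x : 'rV[R]_k.+2 => x ord0 j) (fun t => `|t| `^ a i)).
      exact: (@coord_continuous _ _ _ ord0 j p.2).
    exact/powR_norm_continuous/exp_ge0.
  under eq_fun do rewrite expr2; rewrite expr2; exact: cvgM.
have [|[l x]] := compact_EVT_min (f := f) _ cT (continuous_subspaceT cf).
  by exists (0, 0).
rewrite inE => -[/= lT xT] fmin.
have fE (l' x' : 'rV[R]_k.+2) : (forall j, x' ord0 j \in `[0, b]) ->
    f (l', x') = dist (l' ord0) (x' ord0).
  move=> x'b; apply: eq_bigr => i _; congr ((_ - _) ^+ 2); apply: eq_bigr => j _ /=.
  by rewrite ger0_norm//; move: (x'b j); rewrite in_itv => /andP[].
exists (l ord0), (x ord0); split.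
  by split => // j; move: (lT j); rewrite /= in_itv => /andP[].
move=> lam' x' [lam'0 x'b]; rewrite -fE//.
have [small|] := boolP [forall j, lam' j <= Q].
  have -> : dist lam' x' = f (\row_j lam' j, \row_j x' j).
    rewrite fE; last by move=> j; rewrite mxE.
    apply: eq_bigr => i _; congr ((_ - _) ^+ 2); apply: eq_bigr => j _.
    by rewrite !mxE.
  apply: fmin; rewrite inE; split => j /=; rewrite mxE ?x'b//.
  by rewrite in_itv /= lam'0 (forallP small).
rewrite negb_forall => /existsP[j]; rewrite -ltNge => lamj.
apply: (le_trans (y := V)).
  (* V is the squared distance of v from the apex of the cone. *)
  have -> : V = f (0, 0).
    rewrite fE; last by move=> i; rewrite mxE in_itv /= lexx ltW.
    apply: eq_bigr => i _; rewrite /conic big1 ?sub0r ?sqrrN// => j' _.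
    by rewrite mxE mul0r.
  by apply: fmin; rewrite inE.
rewrite /dist (bigD1 ord0)//= -[V]addr0 lerD//; last first.
  by apply: sumr_ge0 => i _; exact: sqr_ge0.
have cQ : Q <= conic lam' x' ord0.
  rewrite /conic (bigD1 j)//= a0 powRr0 mulr1 -[Q]addr0; apply: lerD; first exact: ltW.
  by apply: sumr_ge0 => i _; rewrite powRr0 mulr1.
have : V + 1 <= conic lam' x' ord0 - v ord0.
  by have := ler_norm (v ord0); move: cQ; rewrite /Q; lra.
by move=> h; nra.
Qed.

(** Let [w] be the difference between the closest point of the cone and [v].
    After [drop_atom] one atom is free to move to any [t] with a small weight,
    so minimality makes the polynomial [w] nonnegative on [0, b]; shrinking
    all the weights bounds its pairing with the closest point.  Together with
    the hypothesis at [w] this forces [w = 0].  One atom more than the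
    dimension makes room for the free one. *)
Lemma conic_hull : (forall c, (forall t, t \in `[0, b] -> 0 <= gpoly a c t) ->
    0 <= \sum_i c i * v i) ->
  exists lam x : 'I_k.+2 -> R, [/\ forall j, 0 <= lam j, forall j, x j \in `[0, b] &
    forall i, v i = \sum_j lam j * x j `^ a i].
Proof.
move=> vP; have [lam [x [[lam0 xb] minlx]]] := closest_conic.
exists lam, x; split => //.
pose w i := conic lam x i - v i.
have w_ge0 t : t \in `[0, b] -> 0 <= gpoly a w t.
  move=> tb.
  have [lam' [j0 [lam'0 lamj0 lamE]]] := drop_atom (\matrix_(j, i) (x j `^ a i)) lam0.
  have {}lamE i : conic lam' x i = conic lam x i.
    have := lamE i; rewrite (eq_bigr (fun j => lam' j * x j `^ a i)) => [lE|j _].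
      by rewrite /conic lE; apply: eq_bigr => j _; rewrite mxE.
    by rewrite mxE.
  rewrite -(pmulr_rge0 _ (ltr0Sn R 1)).
  apply: (@first_order_ge0 _ (\sum_i (t `^ a i) ^+ 2)) => e /andP[e0 _].
  pose lam2 j := if j == j0 then e else lam' j.
  pose x2 j := if j == j0 then t else x j.
  have conic2 i : conic lam2 x2 i = conic lam x i + e * t `^ a i.
    rewrite -lamE /conic (bigD1 j0)//= [in RHS](bigD1 j0)//= lamj0 mul0r add0r addrC.
    rewrite /lam2 /x2 eqxx; congr (_ + _); apply: eq_bigr => j /negbTE jj0.
    by rewrite jj0.
  have : dist lam x <= dist lam2 x2.
    by apply: minlx; split => j; rewrite /lam2 /x2; case: ifP => // _; exact: ltW.
  have -> : dist lam2 x2 = dist lam x + (e * (2 * gpoly a w t) +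
      e ^+ 2 * \sum_i (t `^ a i) ^+ 2).
    rewrite /dist /gpoly !big_distrr -!big_split; apply: eq_bigr => i _ /=.
    by rewrite conic2 /w; ring.
  by rewrite lerDl.
have ww : \sum_i w i * conic lam x i <= 0.
  rewrite -oppr_ge0 -(pmulr_rge0 _ (ltr0Sn R 1)).
  apply: (@first_order_ge0 _ (\sum_i (conic lam x i) ^+ 2)) => e /andP[e0 e1].
  pose lam2 j := (1 - e) * lam j.
  have conic2 i : conic lam2 x i = conic lam x i - e * conic lam x i.
    rewrite -[in X in X - _](mul1r (conic _ _ _)) -mulrBl /conic big_distrr.
    by apply: eq_bigr => j _; rewrite /= mulrA.
  have : dist lam x <= dist lam2 x.
    by apply: minlx; split => j //; rewrite mulr_ge0// subr_ge0.
  have -> : dist lam2 x = dist lam x + (e * (2 * - (\sum_i w i * conic lam x i)) +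
      e ^+ 2 * \sum_i (conic lam x i) ^+ 2).
    rewrite /dist -sumrN !big_distrr -!big_split; apply: eq_bigr => i _ /=.
    by rewrite conic2 /w; ring.
  by rewrite lerDl.
have wv := vP _ w_ge0.
have : \sum_i w i ^+ 2 <= 0.
  have -> : \sum_i w i ^+ 2 = \sum_i w i * conic lam x i - \sum_i w i * v i.
    by rewrite -sumrB; apply: eq_bigr => i _; rewrite -mulrBr.
  by rewrite subr_le0 (le_trans ww).
move=> ws i; apply/esym/eqP; rewrite -subr_eq0 -[_ - _]/(w i) -sqrf_eq0.
have : \sum_i w i ^+ 2 == 0.
  by rewrite eq_le ws sumr_ge0// => j _; exact: sqr_ge0.
by rewrite psumr_eq0 => [/allP/(_ i)|j _]; [rewrite mem_index_enum; apply|exact: sqr_ge0].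
Qed.

End ConicHull.

Section AtomicMeasure.
Variable R : realType.

Lemma gpoly_integral (mu : {measure set (measurableTypeR R) -> \bar R}) (K : set (measurableTypeR R))
    k (a c m : 'I_k -> R) : measurable K ->
  (forall i, mu.-integrable K (EFin \o (fun t => t `^ a i))) ->
  (forall i, (\int[mu]_(t in K) (t `^ a i)%:E)%E = (m i)%:E) ->
  mu.-integrable K (EFin \o gpoly a c) /\
  (\int[mu]_(t in K) (gpoly a c t)%:E)%E = (\sum_i c i * m i)%:E.
Proof.
move=> mK int_i int_e.
have E t : (gpoly a c t)%:E = (\sum_i (c i)%:E * (t `^ a i)%:E)%E.
  by rewrite /gpoly -sumEFin; apply: eq_bigr => i _; rewrite EFinM.
have intZ i : mu.-integrable K (fun t => (c i)%:E * (t `^ a i)%:E)%E.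
  exact: (integrableZl mK (c i) (int_i i)).
split.
  have -> : EFin \o gpoly a c = (fun t => \sum_i (c i)%:E * (t `^ a i)%:E)%E.
    by apply/funext => t /=; rewrite E.
  by apply: integrable_sum => // i _; exact: intZ.
under eq_integral do rewrite E.
rewrite integral_sum// -sumEFin; apply: eq_bigr => i _.
by rewrite (integralZl mK (int_i i)) /= int_e EFinM.
Qed.

Lemma atomic_measure k (lam x : 'I_k.+1 -> R) (K : set (measurableTypeR R)) :
  measurable K -> (forall j, 0 <= lam j) -> (forall j, K (x j)) ->
  exists mu : {measure set (measurableTypeR R) -> \bar R}, forall f : measurableTypeR R -> R,
    measurable_fun setT f -> (forall t, 0 <= f t) ->
    mu.-integrable K (EFin \o f) /\
    (\int[mu]_(t in K) (f t)%:E)%E = (\sum_j lam j * f (x j))%:E.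
Proof.
move=> mK lam0 Kx.
pose mj (j : nat) : {measure set (measurableTypeR R) -> \bar R} :=
  mscale (NngNum (lam0 (inord j))) (\d_ (x (inord j) : measurableTypeR R)).
exists (msum mj k.+1) => f mf f0.
have /measurable_EFinP mf' := measurable_funS measurableT (@subsetT _ K) mf.
have int_f : (\int[msum mj k.+1]_(t in K) (f t)%:E)%E = (\sum_j lam j * f (x j))%:E.
  rewrite ge0_integral_measure_sum//; last by move=> t _; rewrite lee_fin.
  rewrite -sumEFin; apply: eq_bigr => j _.
  rewrite ge0_integral_mscale//; last by move=> t _; rewrite lee_fin.
  by rewrite integral_dirac// diracE mem_set// mul1e /= inord_val EFinM.
split => //; apply/integrableP; split => //.
under eq_integral do rewrite /= ger0_norm//.
by rewrite int_f ltry.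
Qed.

End AtomicMeasure.

(** * Extremal generalized polynomials are node polynomials *)

Section ExtremalPolynomials.
Variable R : realType.
Implicit Types (f : R -> R) (ns : seq (node R)) (xs : seq R).

Lemma vanishes_cat f ns1 ns2 : vanishes f ns1 -> vanishes f ns2 -> vanishes f (ns1 ++ ns2).
Proof.
move=> v1 v2 i; rewrite rows_cat /nth_row nth_cat.
by case: ifP => _; [exact: v1|exact: v2].
Qed.

Lemma vanishes_Single f z : f z = 0 -> vanishes f [:: Single z].
Proof. by move=> fz [|i] //=; rewrite /nth_row nth_default. Qed.

(** An interior zero of a nonnegative function is a minimum, hence a double
    zero. *)
Lemma gpoly_Double_zeros k (a c : 'I_k -> R) b xs :
  (forall t, t \in `[0, b] -> 0 <= gpoly a c t) ->
  (forall x, x \in xs -> 0 < x < b /\ gpoly a c x = 0) ->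
  vanishes (gpoly a c) [seq Double z | z <- xs].
Proof.
move=> c0; elim: xs => [|x xs IH] xsP; first by move=> i; rewrite /nth_row nth_nil.
rewrite -cat1s map_cat; apply: vanishes_cat; last first.
  by apply: IH => y yxs; apply: xsP; rewrite inE yxs orbT.
have [/andP[x0 xb] cx] := xsP x (mem_head _ _).
move=> [|[|i]] //=; last by rewrite /nth_row nth_default.
have xb' : x \in `]0, b[ by rewrite in_itv /= x0.
rewrite /nth_row /= derive1E.
suff ? : is_derive x 1 (gpoly a c) 0 by rewrite derive_val.
apply: (derive1_at_min (ltW (lt_trans x0 xb)) _ xb') => t; rewrite in_itv /= => /andP[t0 tb].
  by have ? := is_derive_gpoly a c t0; exact: ex_derive.
by rewrite cx c0// in_itv /= !ltW.
Qed.

(** Evaluating a node polynomial at one of its own rows repeats that row in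
    the determinant. *)
Lemma node_coef_vanishes k (a : 'I_k.+1 -> R) ns : size (rows ns) = k ->
  path <%R 0 (map (@pt R) ns) -> vanishes (gpoly a (node_coef a ns)) ns.
Proof.
move=> sz pos i; have [ik|ki] := ltnP i k; last by rewrite /nth_row nth_default// sz.
rewrite rows_gpoly//; set r := nth_row (rows ns) i.
have E : rows ns = take i (rows ns) ++ r :: drop i.+1 (rows ns).
  by rewrite -drop_nth ?cat_take_drop// sz.
transitivity (row_det (powers a) (r :: rows ns)).
  rewrite [RHS](@row_det_expand _ _ _ [::] _ ord0)//.
  by apply: eq_bigr => j _; rewrite mulrC.
by rewrite E row_det_dup// size_take sz ik.
Qed.

(** A point at which the node polynomial is positive completes the nodes to an
    invertible system, whose solution is determined by the value there. *)
Lemma multiple_of_node_poly k (a c : 'I_k.+1 -> R) ns b : increasing_exp a ->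
  path <%R 0 (map (@pt R) ns) -> size (rows ns) = k -> 0 < b ->
  (forall t, t \in `[0, b] -> 0 <= gpoly a c t) -> vanishes (gpoly a c) ns ->
  exists2 r, 0 <= r & forall i, c i = r * node_coef a ns i.
Proof.
move=> ai pos sz b0 c0 cns.
have [t [t0 tb pt0]] := node_poly_gt0_near0 ai pos sz b0.
pose r := gpoly a c t / node_poly a ns t.
exists r; first by rewrite divr_ge0 ?(ltW pt0)// c0// in_itv /= ltW.
pose w : 'cV[R]_k.+1 := \col_i (c i - r * node_coef a ns i).
pose M := row_mx_of (powers a) (rows (Single t :: ns)).
have Mu : M \in unitmx.
  by rewrite unitmxE unitfE -[\det M]/(row_det _ _) node_polyE gt_eqF.
suff Mw : M *m w = 0.
  have w0 : w = 0 by rewrite -[w](mulKmx Mu) Mw mulmx0.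
  by move=> i; have /colP/(_ i) := w0; rewrite !mxE => /eqP; rewrite subr_eq0 => /eqP.
apply/colP => i; rewrite !mxE.
transitivity (\sum_j c j * nth_row (rows (Single t :: ns)) i (powers a j) -
  r * \sum_j node_coef a ns j * nth_row (rows (Single t :: ns)) i (powers a j)).
  rewrite big_distrr -sumrB; apply: eq_bigr => j _ /=; rewrite !mxE; ring.
case: (unliftP ord0 i) => [j|] ->.
  rewrite [nth_row _ _]/(nth_row (rows ns) j).
  have := node_coef_vanishes a sz pos j; have := cns j.
  by rewrite !rows_gpoly// => -> ->; rewrite mulr0 subr0.
by rewrite [X in X - _]/(gpoly a c t) [X in r * X]/(node_poly a ns t) divfK ?subrr// gt_eqF.
Qed.

Lemma path_rcons_lt (x y : R) (s : seq R) : path <%R x s -> all (< y) (x :: s) ->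
  path <%R x (rcons s y).
Proof.
by move=> xs /allP all_y; rewrite rcons_path xs; apply: all_y; exact: mem_last.
Qed.

End ExtremalPolynomials.

Section PositiveOnGpolys.
Variables (R : realType) (n : nat) (a : 'I_n.+2 -> R) (b : R) (v : 'I_n.+2 -> R).
Hypotheses (ai : increasing_exp a) (a0 : a ord0 = 0) (b0 : 0 < b).

Let a' i := a (lift ord0 i).
Let Lam c := \sum_i c i * v i.
Let Lam' c := \sum_i c i * v (lift ord0 i).

Let ai' : increasing_exp a'. Proof. by move=> i j ij; apply: ai. Qed.

Hypothesis even_ge0 : forall m xs, n.+1 = m.*2 -> size xs = m -> path <%R 0 (rcons xs b) ->
  0 <= Lam (node_coef a [seq Double z | z <- xs]) /\
  0 <= Lam' (node_coef a' (rcons [seq Double z | z <- take m.-1 xs] (Single b))).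
Hypothesis odd_ge0 : forall m xs, n.+1 = m.*2.+1 -> size xs = m -> path <%R 0 (rcons xs b) ->
  0 <= Lam' (node_coef a' [seq Double z | z <- xs]) /\
  0 <= Lam (node_coef a (rcons [seq Double z | z <- xs] (Single b))).

Lemma gpoly_behead c t : c ord0 = 0 -> gpoly a c t = gpoly a' (fun i => c (lift ord0 i)) t.
Proof. by move=> c0; rewrite /gpoly big_ord_recl c0 mul0r add0r. Qed.

Lemma gpoly_at0 c : gpoly a c 0 = c ord0.
Proof.
rewrite /gpoly big_ord_recl a0 powRr0 mulr1 big1 ?addr0// => i _.
by rewrite powR0 ?mulr0// gt_eqF// -a0; exact: ai.
Qed.

Lemma Lam_ge0_multiple c ns : path <%R 0 (map (@pt R) ns) -> size (rows ns) = n.+1 ->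
  (forall t, t \in `[0, b] -> 0 <= gpoly a c t) -> vanishes (gpoly a c) ns ->
  0 <= Lam (node_coef a ns) -> 0 <= Lam c.
Proof.
move=> pos sz c0 cns; have [r r0 cE] := multiple_of_node_poly ai pos sz b0 c0 cns.
suff -> : Lam c = r * Lam (node_coef a ns) by exact: mulr_ge0.
by rewrite /Lam big_distrr; apply: eq_bigr => i _ /=; rewrite cE -mulrA.
Qed.

Lemma Lam_ge0_multiple' c ns : c ord0 = 0 ->
  path <%R 0 (map (@pt R) ns) -> size (rows ns) = n ->
  (forall t, t \in `[0, b] -> 0 <= gpoly a c t) -> vanishes (gpoly a c) ns ->
  0 <= Lam' (node_coef a' ns) -> 0 <= Lam c.
Proof.
move=> c00 pos sz c0 cns.
have E : gpoly a c = gpoly a' (fun i => c (lift ord0 i)).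
  by apply/funext => t; exact: gpoly_behead.
rewrite E in c0 cns; have [r r0 cE] := multiple_of_node_poly ai' pos sz b0 c0 cns.
suff -> : Lam c = r * Lam' (node_coef a' ns) by exact: mulr_ge0.
rewrite /Lam big_ord_recl c00 mul0r add0r /Lam' big_distrr.
by apply: eq_bigr => i _ /=; rewrite cE -mulrA.
Qed.

(** Both summands of [snake] vanish at every second point of the alternation,
    twice at the interior ones.  If the first point were positive, or the last
    one less than [b], one of the summands would have more zeros than
    [gpoly_zeros] allows and would be 0, whereas the sum is positive at each
    zero of the other summand.  Hence the zeros are exactly those of a node
    polynomial of the statement. *)
Lemma Lam_ge0 d : (forall t, t \in `[0, b] -> 0 < gpoly a d t) -> 0 <= Lam d.
Proof.
move=> d0; have [c1 [c2 [t [c10 c20 cd [t0 tn tinc tz]]]]] := snake ai a0 b0 d0.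
suff [L1 L2] : 0 <= Lam c1 /\ 0 <= Lam c2.
  suff -> : Lam d = Lam c1 + Lam c2 by apply: addr_ge0.
  by rewrite /Lam -big_split; apply: eq_bigr => i _; rewrite /= -cd mulrDl.
have tlt i j : (i < j)%N -> (j <= n.+1)%N -> t i < t j.
  elim: j => [//|j IH]; rewrite ltnS leq_eqVlt => /orP[/eqP->|ij] jn; first exact: tinc.
  by apply: lt_trans (tinc j jn); exact: IH (ltnW jn).
have tle i j : (i <= j)%N -> (j <= n.+1)%N -> t i <= t j.
  by rewrite leq_eqVlt => /orP[/eqP->//|ij jn]; exact/ltW/tlt.
have tb i : (i <= n.+1)%N -> t i \in `[0, b].
  by move=> ile; rewrite in_itv /= (le_trans t0 (tle 0 i _ _))//= (le_trans _ tn)// tle.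
have toob i : (0 < i)%N -> (i < n.+1)%N -> 0 < t i < b.
  by move=> i0 ile; rewrite (le_lt_trans t0 (tlt 0 i _ _))//= ?(lt_le_trans _ tn) ?tlt// ltnW.
have split_d x : gpoly a d x = gpoly a c1 x + gpoly a c2 x.
  by rewrite /gpoly -big_split; apply: eq_bigr => i _; rewrite /= -cd mulrDl.
have z1 i : ~~ odd i -> (i <= n.+1)%N -> gpoly a c1 (t i) = 0.
  by move=> /negbTE oi /tz; rewrite oi.
have z2 i : odd i -> (i <= n.+1)%N -> gpoly a c2 (t i) = 0.
  by move=> oi /tz; rewrite oi.
have c1N0 : ~ (forall i, c1 i = 0).
  move=> c1_0; have := d0 _ (tb 1%N isT); rewrite split_d z2// addr0 /gpoly big1 ?ltxx// => i _.
  by rewrite c1_0 mul0r.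
have c2N0 : ~ (forall i, c2 i = 0).
  move=> c2_0; have := d0 _ (tb 0%N isT); rewrite split_d z1// add0r /gpoly big1 ?ltxx// => i _.
  by rewrite c2_0 mul0r.
pose ts f m := [seq t (f i) | i <- iota 0 m].
have ts_sorted (f : nat -> nat) m x : (forall i j, (i < j)%N -> (f i < f j)%N) ->
    (forall i, (i < m)%N -> (f i <= n.+1)%N /\ x < t (f i)) -> path <%R x (ts f m).
  move=> fi fm; rewrite (path_sortedE lt_trans); apply/andP; split.
    by apply/allP => y /mapP[i]; rewrite mem_iota add0n => /fm[_ ?] ->.
  rewrite sorted_map; apply: (@sub_in_sorted _ (gtn m) ltn).
  - by move=> i j _ /fm[jn _] ij; apply: tlt => //; exact: fi.
  - by apply/allP => i; rewrite mem_iota add0n.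
  - exact: iota_ltn_sorted.
have ts_rcons (f : nat -> nat) m : ts f m.+1 = rcons (ts f m) (t (f m)).
  by rewrite /ts -addn1 iotaD map_cat cats1.
have size_ts (f : nat -> nat) m : size (ts f m) = m by rewrite size_map size_iota.
have ts_lt (f : nat -> nat) m y : path <%R 0 (ts f m) -> 0 < y ->
    (forall i, (i < m)%N -> t (f i) < y) -> path <%R 0 (rcons (ts f m) y).
  move=> tsP y0 fy; apply: path_rcons_lt => //=; rewrite y0 /=.
  by apply/allP => x /mapP[i]; rewrite mem_iota add0n => /fy ? ->.
have vD (c : 'I_n.+2 -> R) (f : nat -> nat) m :
    (forall x, x \in `[0, b] -> 0 <= gpoly a c x) ->
    (forall i, (i < m)%N -> 0 < t (f i) < b /\ gpoly a c (t (f i)) = 0) ->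
    vanishes (gpoly a c) [seq Double z | z <- ts f m].
  move=> c0 fP; apply: (gpoly_Double_zeros c0) => x /mapP[i].
  by rewrite mem_iota add0n => /fP ? ->.
(* Indices of the zeros of c1 other than t 0, and of the zeros of c2. *)
pose fE i := i.+1.*2; pose fO i := i.*2.+1.
have fEi i j : (i < j)%N -> (fE i < fE j)%N by rewrite /fE ltn_double ltnS.
have fOi i j : (i < j)%N -> (fO i < fO j)%N by rewrite /fO ltnS ltn_double.
have t_last_lt : t n.+1 != b -> t n.+1 < b by move=> tb'; rewrite lt_neqAle tb'.
have t_0_gt : t 0%N != 0 -> 0 < t 0%N by move=> t0'; rewrite lt_neqAle eq_sym t0'.
have t0b : t 0%N < b by apply: lt_le_trans (tlt 0%N n.+1 isT (leqnn _)) tn.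
have [m En] : exists m, n.+1 = m.*2.+1 \/ n.+1 = m.+1.*2.
  exists n./2; rewrite -{1 3}(odd_double_half n); case: odd; last by left.
  by right; rewrite add1n doubleS.
have ltE i : (i < m)%N -> (fE i < n.+1)%N.
  by move=> im; rewrite /fE; case: En => ->; [rewrite ltnS leq_double|rewrite ltn_double ltnS].
(* Otherwise t 0 is a double zero of c1, which then has one zero too many.  For
   n.+1 even the last zero t n.+1 belongs to c1 as well. *)
have t0_0 : t 0%N = 0.
  apply/eqP; apply: contra_notT c1N0 => /t_0_gt t0_gt.
  have dP i : (i < m.+1)%N -> (i.*2 < n.+1)%N.
    by rewrite ltnS => im; case: En => ->; [rewrite ltnS leq_double|rewrite ltn_double ltnS].
  have v0 : vanishes (gpoly a c1) [seq Double z | z <- ts double m.+1].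
    apply: vD => // i im; rewrite z1 ?odd_double//; last exact/ltnW/dP.
    split => //; case: i im => [|i] im; first by rewrite t0_gt t0b.
    by apply: toob => //; exact: dP.
  have pd : path <%R 0 (ts double m.+1).
    apply: ts_sorted => [i j|i im]; first by rewrite ltn_double.
    by split; [exact/ltnW/dP|apply: lt_le_trans t0_gt (tle _ _ _ (ltnW (dP i im)))].
  case: En => En.
    apply: (gpoly_zeros ai (ns := [seq Double z | z <- ts double m.+1])) => //.
      by rewrite pt_Double.
    by rewrite size_rows_Double size_ts En.
  apply: (gpoly_zeros ai
    (ns := rcons [seq Double z | z <- ts double m.+1] (Single (t n.+1)))) => //.
  - rewrite map_rcons pt_Double; apply: ts_lt => //.
      exact: lt_le_trans t0_gt (tle _ _ _ _).
    by move=> i im; apply: tlt => //; exact: dP.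
  - by rewrite -cats1 rows_cat size_cat size_rows_Double size_ts addn1 En.
  - rewrite -cats1; apply: vanishes_cat => //; apply: vanishes_Single; apply: z1 => //.
    by rewrite En odd_double.
have c1_0 : c1 ord0 = 0 by rewrite -gpoly_at0 -t0_0 z1.
have vE : vanishes (gpoly a c1) [seq Double z | z <- ts fE m].
  apply: vD => // i im; split; first by apply: toob => //; exact: ltE.
  by rewrite z1 ?odd_double//; exact/ltnW/ltE.
have pE : path <%R 0 (ts fE m).
  apply: ts_sorted => // i im; split; first exact/ltnW/ltE.
  by have /andP[] := toob (fE i) isT (ltE i im).
have eltb i : (i < m)%N -> t (fE i) < b by move=> /ltE /(toob (fE i) isT) /andP[].
case: En => En.
- have ltO i : (i < m)%N -> (fO i < n.+1)%N.
    by move=> im; rewrite /fO En ltnS ltn_double.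
  have pO : path <%R 0 (ts fO m).
    apply: ts_sorted => // i im; split; first exact/ltnW/ltO.
    by have /andP[] := toob (fO i) isT (ltO i im).
  have oltb i : (i < m)%N -> t (fO i) < b by move=> /ltO /(toob (fO i) isT) /andP[].
  have vO : vanishes (gpoly a c2) [seq Double z | z <- ts fO m].
    apply: vD => // i im; split; first by apply: toob => //; exact: ltO.
    by rewrite z2 /= ?odd_double//; exact/ltnW/ltO.
  have oddn : odd n.+1 by rewrite En /= odd_double.
  have tn_b : t n.+1 = b.
    apply/eqP; apply: contra_notT c2N0 => /t_last_lt tn_lt.
    (* An interior last zero would be a double one, which is too many for c2. *)
    have fOm : fO m = n.+1 by rewrite En.
    apply: (gpoly_zeros ai (ns := [seq Double z | z <- ts fO m.+1])).
    - rewrite pt_Double ts_rcons fOm; apply: ts_lt => //.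
        by rewrite -t0_0; exact: tlt.
      by move=> i im; apply: tlt => //; exact: ltO.
    - by rewrite size_rows_Double size_ts En.
    - apply: vD => // i; rewrite ltnS leq_eqVlt => /orP[/eqP ->|im].
        by rewrite fOm z2// tn_lt -{1}t0_0 tlt.
      split; first by apply: toob => //; exact: ltO.
      by rewrite z2 /= ?odd_double//; exact/ltnW/ltO.
  split.
    apply: (Lam_ge0_multiple' (ns := [seq Double z | z <- ts fE m])) => //.
    + by rewrite pt_Double.
    + by rewrite size_rows_Double size_ts; case: En.
    + by have [|] := odd_ge0 En (size_ts fE m) => //; exact: ts_lt.
  apply: (Lam_ge0_multiple (ns := rcons [seq Double z | z <- ts fO m] (Single b))) => //.
  + by rewrite map_rcons pt_Double; exact: ts_lt.
  + by rewrite -cats1 rows_cat size_cat size_rows_Double size_ts addn1.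
  + rewrite -cats1; apply: vanishes_cat => //; apply: vanishes_Single.
    by rewrite -tn_b z2.
  + by have [|] := odd_ge0 En (size_ts fO m) => //; exact: ts_lt.
- have ltO i : (i < m.+1)%N -> (fO i < n.+1)%N.
    by move=> im; rewrite /fO En doubleS !ltnS leq_double.
  have pO : path <%R 0 (ts fO m.+1).
    apply: ts_sorted => // i im; split; first exact/ltnW/ltO.
    by have /andP[] := toob (fO i) isT (ltO i im).
  have oltb i : (i < m.+1)%N -> t (fO i) < b by move=> /ltO /(toob (fO i) isT) /andP[].
  have vO : vanishes (gpoly a c2) [seq Double z | z <- ts fO m.+1].
    apply: vD => // i im; split; first by apply: toob => //; exact: ltO.
    by rewrite z2 /= ?odd_double//; exact/ltnW/ltO.
  have evenn : ~~ odd n.+1 by rewrite En odd_double.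
  have tn_b : t n.+1 = b.
    apply/eqP; apply: contra_notT c1N0 => /t_last_lt tn_lt.
    (* As t 0 is 0, c1 combines the powers of positive exponent only, so that its
       zeros are counted against one function less. *)
    have fEm : fE m = n.+1 by rewrite En.
    suff c1'0 : forall i, c1 (lift ord0 i) = 0.
      by move=> i; case: (unliftP ord0 i) => [j|] ->.
    apply: (gpoly_zeros ai' (ns := [seq Double z | z <- ts fE m.+1])).
    - rewrite pt_Double ts_rcons fEm; apply: ts_lt => //.
        by rewrite -t0_0; exact: tlt.
      by move=> i im; apply: tlt => //; exact: ltE.
    - by rewrite size_rows_Double size_ts En.
    - rewrite (_ : gpoly a' _ = gpoly a c1); last first.
        by apply/funext => x; rewrite gpoly_behead.
      apply: vD => // i; rewrite ltnS leq_eqVlt => /orP[/eqP ->|im].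
        by rewrite fEm z1// tn_lt -{1}t0_0 tlt.
      split; first by apply: toob => //; exact: ltE.
      by rewrite z1 ?odd_double//; exact/ltnW/ltE.
  split; last first.
    apply: (Lam_ge0_multiple (ns := [seq Double z | z <- ts fO m.+1])) => //.
    + by rewrite pt_Double.
    + by rewrite size_rows_Double size_ts.
    + by have [|] := even_ge0 En (size_ts fO m.+1) => //; exact: ts_lt.
  apply: (Lam_ge0_multiple' (ns := rcons [seq Double z | z <- ts fE m] (Single b))) => //.
  + by rewrite map_rcons pt_Double; exact: ts_lt.
  + rewrite -cats1 rows_cat size_cat size_rows_Double size_ts addn1.
    by move: En; rewrite doubleS => -[].
  + rewrite -cats1; apply: vanishes_cat => //; apply: vanishes_Single.
    by rewrite -tn_b z1.
  + have := @even_ge0 m.+1 (rcons (ts fE m) (t (fO m))) En.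
    rewrite size_rcons size_ts -[X in take _ X]cats1 take_size_cat ?size_ts// => /(_ erefl)[]//.
    rewrite rcons_path last_rcons oltb// andbT; apply: ts_lt => //.
      by have /andP[] := toob (fO m) isT (ltO m (ltnSn m)).
    by move=> i im; apply: tlt; [rewrite /fE /fO ltnS leq_double|exact/ltnW/ltO].
Qed.

End PositiveOnGpolys.

(** * Moment functionals *)

Section LinearFunctionals.
Variables (R : realType) (k : nat) (F : 'I_k -> R -> R) (L : (R -> R) -> R).

Lemma linear_functional_sum (c : 'I_k -> R) : linear_functional_on (lin F) L ->
  L (fun t => \sum_i c i * F i t) = \sum_i c i * L (F i).
Proof.
move=> L_lin.
have linD x f g : lin F f -> lin F g -> lin F (fun t => x * f t + g t).
  move=> [cf ->] [cg ->]; exists (fun i => x * cf i + cg i); apply/funext => t.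
  by rewrite big_distrr -big_split; apply: eq_bigr => i _; rewrite /= mulrDl mulrA.
have lin0 : lin F (fun=> 0).
  by exists (fun=> 0); apply/funext => t; rewrite big1// => i _; rewrite mul0r.
have linF i : lin F (F i).
  exists (fun j => (j == i)%:R); apply/funext => t.
  by rewrite (bigD1 i)//= eqxx mul1r big1 ?addr0// => j /negbTE ->; rewrite mul0r.
have L0 : L (fun=> 0) = 0.
  have := L_lin 1 _ _ lin0 lin0; under eq_fun do rewrite mulr0 addr0.
  by rewrite mul1r => /eqP; rewrite -subr_eq0 opprD addNKr oppr_eq0 => /eqP.
suff [] : lin F (fun t => \sum_i c i * F i t) /\
    L (fun t => \sum_i c i * F i t) = \sum_i c i * L (F i) by [].
elim: (index_enum _) => [|i s [lin_s L_s]].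
  by rewrite big_nil; under eq_fun do rewrite big_nil.
rewrite big_cons; under eq_fun do rewrite big_cons.
by split; [exact: linD|rewrite L_lin// L_s].
Qed.

End LinearFunctionals.

Section MomentFunctionals.
Variables (R : realType) (n : nat) (a : 'I_n.+2 -> R) (b : R) (L : (R -> R) -> R).
Hypotheses (ai : increasing_exp a) (a0 : a ord0 = 0) (b0 : 0 < b).
Hypothesis L_linear : linear_functional_on (lin (powers a)) L.

Let a' (i : 'I_n.+1) := a (lift ord0 i).
Let v i := L (powers a i).

Lemma functional_gpoly c : L (gpoly a c) = \sum_i c i * v i.
Proof. exact: linear_functional_sum. Qed.

Lemma node_det_full ns :
  (fun t => \det (node_mx (powers a) (Single t :: ns))) = gpoly a (node_coef a ns).
Proof. by apply/funext => t; exact: node_polyE. Qed.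

(** Coefficients of a combination of the powers of positive exponent, seen among
    all the powers. *)
Definition pad0 (c : 'I_n.+1 -> R) (i : 'I_n.+2) := oapp c 0 (unlift ord0 i).

Lemma pad0_lift c j : pad0 c (lift ord0 j) = c j.
Proof. by rewrite /pad0 liftK. Qed.

Lemma pad0_ord0 c : pad0 c ord0 = 0.
Proof. by rewrite /pad0 unlift_none. Qed.

Lemma node_det_behead ns :
  (fun t => \det (node_mx (powers a') (Single t :: ns))) =
  gpoly a (pad0 (node_coef a' ns)).
Proof.
apply/funext => t; rewrite [LHS]node_polyE /gpoly [RHS]big_ord_recl pad0_ord0 mul0r add0r.
by apply: eq_bigr => j _; rewrite pad0_lift.
Qed.

Lemma functional_pad0 c : L (gpoly a (pad0 c)) = \sum_j c j * v (lift ord0 j).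
Proof.
rewrite functional_gpoly big_ord_recl pad0_ord0 mul0r add0r.
by apply: eq_bigr => j _; rewrite pad0_lift.
Qed.

Lemma moment_functional_ge0 c : truncated_moment_functional `[0, b] (lin (powers a)) L ->
  (forall t, t \in `[0, b] -> 0 <= gpoly a c t) -> 0 <= L (gpoly a c).
Proof.
move=> [mu muP] c0; have [|_ Lc] := muP (gpoly a c); first by exists c.
by rewrite -lee_fin Lc; apply: integral_ge0 => t tb; rewrite lee_fin c0.
Qed.

(** Adding a small constant makes a nonnegative polynomial positive, which
    gives the hypothesis of [conic_hull]; the atoms found there are the
    measure. *)
Lemma nonneg_moment_functional :
  (forall c, (forall t, t \in `[0, b] -> 0 < gpoly a c t) -> 0 <= \sum_i c i * v i) ->
  truncated_moment_functional `[0, b] (lin (powers a)) L.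
Proof.
move=> pos.
have nonneg c : (forall t, t \in `[0, b] -> 0 <= gpoly a c t) -> 0 <= \sum_i c i * v i.
  move=> c0; apply: (@first_order_ge0 _ _ (v ord0)) => e /andP[e0 _].
  have E : \sum_i (c i + e * (i == ord0)%:R) * v i = \sum_i c i * v i + e * v ord0.
    under eq_bigr do rewrite mulrDl; rewrite big_split /=; congr (_ + _).
    by rewrite (bigD1 ord0)//= mulr1 big1 ?addr0// => i /negbTE ->; rewrite mulr0 mul0r.
  rewrite expr2 -mulrA -mulrDr mulr_ge0 ?(ltW e0)// -E; apply: pos => t tb.
  rewrite gpolyD ltr_wpDl ?c0// mulr_gt0//.
  rewrite /gpoly (bigD1 ord0)//= a0 powRr0 mulr1 big1 ?addr0// => i /negbTE ->.
  by rewrite mul0r.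
have [lam [x [lam0 xb vE]]] := conic_hull ai a0 b0 nonneg.
have mK : measurable (`[0, b] : set (measurableTypeR R)) by exact: measurable_itv.
have [mu muP] := atomic_measure mK lam0 (fun j => xb j).
have muX i := muP _ (measurable_powR (a i)) (fun t => powR_ge0 t (a i)).
exists mu => _ [c ->]; rewrite -/(gpoly a c) functional_gpoly.
have [int_c ->] := gpoly_integral c mK (fun i => (muX i).1) (fun i => (muX i).2).
split => //; congr (_%:E); apply: eq_bigr => i _; congr (_ * _); exact: vE.
Qed.

End MomentFunctionals.

Theorem corollary5p2p4 (R : realType) (n : nat) (alpha : 'I_n.+1 -> R) (b : R)
    (L : (R -> R) -> R)
    (n_gt0 : (0 < n)%N)
    (alpha0 : alpha ord0 = 0)
    (alpha_incr : forall i j : 'I_n.+1, (i < j)%N -> alpha i < alpha j)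
    (b_gt0 : 0 < b)
    (L_linear : linear_functional_on (lin (powers alpha)) L) :
  truncated_moment_functional `[0, b] (lin (powers alpha)) L
  <->
  forall (m : nat) (x : m.-tuple R), path <%R 0 (rcons x b) ->
    (n = (2 * m)%N ->
       0 <= L (fun t => \det (node_mx (powers alpha)
                 (Single t :: [seq Double z | z <- x])))
       /\
       0 <= L (fun t => \det (node_mx (powers (fun i : 'I_n => alpha (lift ord0 i)))
                 (Single t :: rcons [seq Double z | z <- take m.-1 x]
                                    (Single b)))))
    /\
    (n = (2 * m + 1)%N ->
       0 <= L (fun t => \det (node_mx (powers (fun i : 'I_n => alpha (lift ord0 i)))
                 (Single t :: [seq Double z | z <- x])))
       /\
       0 <= L (fun t => \det (node_mx (powers alpha)
                 (Single t :: rcons [seq Double z | z <- x] (Single b))))).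
Proof.
case: n alpha n_gt0 alpha0 alpha_incr L_linear => [//|n] a _ a0 ai L_linear.
have ai' : increasing_exp (fun i : 'I_n.+1 => a (lift ord0 i)) by move=> i j ij; exact: ai.
have a'0 : 0 <= a (lift ord0 ord0) by apply/ltW; rewrite -a0; exact: ai.
have a0' : 0 <= a ord0 by rewrite a0.
split=> [momL m x xP|L_ge0].
  have xs0 : path <%R 0 x.
    by move: xP; rewrite rcons_path => /andP[].
  have full ns : path <%R 0 (map (@pt R) ns) -> size (rows ns) = n.+1 ->
      (forall t, t <= b -> ~~ odd (size (rows (below t ns)))) ->
      0 <= L (fun t => \det (node_mx (powers a) (Single t :: ns))).
    move=> pos sz ev; rewrite node_det_full; apply: (moment_functional_ge0 momL) => t.
    by rewrite in_itv /= => /andP[t0 tb]; apply: node_poly_ge0 => //; exact: ev.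
  have behead ns : path <%R 0 (map (@pt R) ns) -> size (rows ns) = n ->
      (forall t, t <= b -> ~~ odd (size (rows (below t ns)))) ->
      0 <= L (fun t => \det (node_mx (powers (fun i : 'I_n.+1 => a (lift ord0 i)))
                                     (Single t :: ns))).
    move=> pos sz ev; rewrite node_det_behead; apply: (moment_functional_ge0 momL) => t.
    rewrite in_itv /= => /andP[t0 tb].
    rewrite /gpoly big_ord_recl pad0_ord0 mul0r add0r.
    under eq_bigr do rewrite pad0_lift.
    by apply: (node_poly_ge0 ai' a'0) => //; exact: ev.
  have evD xs t : t <= b -> ~~ odd (size (rows (below t [seq Double z | z <- xs]))).
    by rewrite below_Double size_rows_Double odd_double.
  have evDS xs t : t <= b ->
      ~~ odd (size (rows (below t (rcons [seq Double z | z <- xs] (Single b))))).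
    by move=> tb; rewrite below_rcons// size_rows_Double odd_double.
  have szDS xs : size (rows (rcons [seq Double z | z <- xs] (Single b))) = (size xs).*2.+1.
    by rewrite -cats1 rows_cat size_cat size_rows_Double addn1.
  rewrite mul2n addn1; split=> En; split.
  - by apply: full; [rewrite pt_Double|rewrite size_rows_Double size_tuple|exact: evD].
  - have m0 : (0 < m)%N by case: (m) En.
    apply: behead; last exact: evDS.
      rewrite map_rcons pt_Double; apply: (subseq_path lt_trans _ xP).
      by rewrite -!cats1 cat_subseq ?take_subseq.
    rewrite szDS size_takel ?size_tuple ?leq_pred//.
    by move: En; rewrite -{1}(prednK m0) doubleS => -[].
  - apply: behead; [by rewrite pt_Double| |exact: evD].
    by rewrite size_rows_Double size_tuple; case: En.
  - by apply: full; [rewrite map_rcons pt_Double|rewrite szDS size_tuple|exact: evDS].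
apply: nonneg_moment_functional => // d d0.
apply: (Lam_ge0 (v := fun i => L (powers a i)) ai a0 b_gt0) => // m xs En sz xP.
  have sz' : size xs == m by apply/eqP.
  have [+ _] := L_ge0 m (Tuple sz') xP.
  rewrite mul2n => /(_ En); rewrite node_det_full node_det_behead.
  by rewrite functional_pad0// functional_gpoly.
have sz' : size xs == m by apply/eqP.
have [_ +] := L_ge0 m (Tuple sz') xP.
rewrite mul2n addn1 => /(_ En); rewrite node_det_full node_det_behead.
by rewrite functional_pad0// functional_gpoly.
Qed.
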